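(* Let $r\in\mathbb{N}$ and let $f_1,\dots,f_r\in\mathbb{R}[x_1,\dots,x_d]$ be such that the semi-algebraic set $\mathcal{K}(\mathsf f)=\{x\in\mathbb{R}^d: f_1(x)\ge0,\dots,f_r(x)\ge0\}$ is compact. Then there exist $s\in\mathbb{N}$ and polynomials $p_1,\dots,p_s\in\mathbb{R}[x_1,\dots,x_d]$ such that the following hold: (a) The semiring $S$ of $\mathbb{R}[x_1,\dots,x_d]$ generated by $f_1,\dots,f_r,p_1^2,\dots,p_s^2$ is Archimedean. (b) If $h\in\mathbb{R}[x_1,\dots,x_d]$ satisfies $h(x)>0$ for all $x\in\mathcal{K}(\mathsf f)$, then $h$ is a finite sum of polynomials of the form $$\alpha\, f_1^{e_1}\cdots f_r^{e_r}\, f_1^{2n_1}\cdots f_r^{2n_r}\, p_1^{2k_1}\cdots p_s^{2k_s},$$ where $\alpha\ge0$, $e_1,\dots,e_r\in\{0,1\}$, $n_1,\dots,n_r,k_1,\dots,k_s\in\mathbb{N}_0$. (c) Each linear functional on $\mathbb{R}[x_1,\dots,x_d]$ that is nonnegative on all polynomials of the form displayed in (b) with $\alpha=1$ is a $\mathcal{K}(\mathsf f)$-moment functional.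
   Context: The semiring generated by polynomials $q_1,\dots,q_m$ is the set of all finite sums of terms $\alpha q_1^{n_1}\cdots q_m^{n_m}$ with real $\alpha\ge0$ and $n_1,\dots,n_m\in\mathbb{N}_0$. A semiring $S$ of $\mathbb{R}[x_1,\dots,x_d]$ is Archimedean if for every $a\in\mathbb{R}[x_1,\dots,x_d]$ there exists $\lambda>0$ with $\lambda-a\in S$. For a closed set $K\subseteq\mathbb{R}^d$, a linear functional $L$ on $\mathbb{R}[x_1,\dots,x_d]$ is a $K$-moment functional if there is a (positive) Radon measure $\mu$ supported on $K$ such that every polynomial is $\mu$-integrable and $L(p)=\int p\,d\mu$ for all polynomials $p$. *)

(* Defs.v *)
From HB Require Import structures.
From mathcomp Require Import all_boot all_order all_algebra.
From mathcomp Require Import all_classical all_reals all_analysis.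
(* Notations of mpoly are not imported: they clash with mathcomp-analysis. *)
From mathcomp Require mpoly.
Import (canonicals, coercions) mpoly.

Set Implicit Arguments.
Unset Strict Implicit.
Unset Printing Implicit Defensive.

Import Order.TTheory GRing.Theory Num.Theory.
Import numFieldNormedType.Exports.

Local Open Scope classical_set_scope.
Local Open Scope ring_scope.

Notation polyring R d := (mpoly.mpoly d R).

Definition peval (R : realType) (d : nat) (p : polyring R d) (x : 'rV[R]_d) : R :=
  mpoly.meval (fun i => x ord0 i) p.

Definition semialg (R : realType) (d r : nat) (f : 'I_r -> polyring R d) :
    set 'rV[R]_d :=
  [set x | forall i, 0 <= peval (f i) x].

Definition semiring_gen (R : realType) (d : nat) (I : finType)
    (q : I -> polyring R d) : set (polyring R d) :=
  [set p | exists N (alpha : 'I_N -> R) (n : 'I_N -> I -> nat),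
    (forall t, 0 <= alpha t) /\
    p = \sum_(t < N) alpha t *: \prod_(i : I) q i ^+ n t i].

Definition archimedean (R : realType) (d : nat) (S : set (polyring R d)) : Prop :=
  forall a : polyring R d, exists lambda : R, 0 < lambda /\ S (lambda%:A - a).

Definition fp_gens (R : realType) (d r s : nat)
    (f : 'I_r -> polyring R d) (p : 'I_s -> polyring R d) (i : 'I_r + 'I_s) : polyring R d :=
  match i with inl j => f j | inr k => p k ^+ 2 end.

(* The exponents e_i in {0, 1} are booleans, coerced to nat. *)
Definition fp_term (R : realType) (d r s : nat)
    (f : 'I_r -> polyring R d) (p : 'I_s -> polyring R d)
    (alpha : R) (e : 'I_r -> bool) (n : 'I_r -> nat) (k : 'I_s -> nat) :
    polyring R d :=
  alpha *: ((\prod_(i < r) f i ^+ e i) * (\prod_(i < r) f i ^+ (2 * n i)) *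
            (\prod_(j < s) p j ^+ (2 * k j))).

Definition fp_sum (R : realType) (d r s : nat)
    (f : 'I_r -> polyring R d) (p : 'I_s -> polyring R d) : set (polyring R d) :=
  [set h | exists N (alpha : 'I_N -> R) (e : 'I_N -> 'I_r -> bool)
      (n : 'I_N -> 'I_r -> nat) (k : 'I_N -> 'I_s -> nat),
    (forall t, 0 <= alpha t) /\
    h = \sum_(t < N) fp_term f p (alpha t) (e t) (n t) (k t)].

(* 'rV[R]_d with its Borel sigma-algebra, for the product topology. *)
Notation borelRd R d := (g_sigma_algebraType (@open 'rV[R]_d)).

(* Locally finite and inner regular Borel measures; on R^d the second
   condition follows from the first, but it is part of the definition. *)
Definition is_radon (R : realType) (d : nat)
    (mu : {measure set (borelRd R d) -> \bar R}) : Prop :=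
  (forall C : set 'rV[R]_d, compact C -> (mu C < +oo)%E) /\
  (forall A : set (borelRd R d), measurable A ->
    mu A = ereal_sup [set mu C | C in [set C : set 'rV[R]_d |
                                        compact C /\ C `<=` A]]).

(* For closed K, mu (~` K) = 0 says that the support of mu is contained in K. *)
Definition moment_functional (R : realType) (d : nat) (K : set 'rV[R]_d)
    (L : {scalar (polyring R d)}) : Prop :=
  exists mu : {measure set (borelRd R d) -> \bar R},
    [/\ is_radon mu,
        mu (~` K) = 0%E,
        (forall p : polyring R d,
           mu.-integrable [set: borelRd R d] (fun x => (peval p x)%:E)) &
        (forall p : polyring R d, ((L p)%:E = \int[mu]_x (peval p x)%:E)%E)].

(* Main.v *)
Require Import Defs.
From HB Require Import structures.
From mathcomp Require Import all_boot all_order all_algebra closed_field.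
From mathcomp Require Import all_classical all_reals all_analysis.
From mathcomp Require Import measurable_realfun.
From mathcomp Require Import ring lra zify.
From mathcomp Require qe_rcf qe_rcf_th.
From mathcomp Require mpoly.
Import (canonicals, coercions) mpoly.

Set Implicit Arguments.
Unset Strict Implicit.
Unset Printing Implicit Defensive.

Import Order.TTheory GRing.Theory Num.Theory.
Import numFieldNormedType.Exports.

Local Open Scope classical_set_scope.
Local Open Scope ring_scope.

(** Write K for the compact set [semialg f] and T for the preordering generated
by f, that is, the sums of products of members of f and of arbitrary squares.

Part (a). Choose c with g := c - |x|^2 > 0 on K. If -1 were not of the form
s - g t with s, t in T, the preordering T - g T would extend to a prime cone P
([exists_prime_cone]). Such a P is the pullback of the nonnegative elements
under a ring morphism into a real closed field F ([prime_cone_real_closed]), so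
f >= 0 and -g >= 0 hold at an F-point, and quantifier elimination transports
this to a real point ([prime_cone_point]), against the choice of g. Hence
g t = 1 + s ([exists_negative_certificate]). In the preordering generated by g
alone every polynomial is bounded by a constant, so k - s = u + g v with sums of
squares u, v; multiplying by 1 + s = g t lands in T, completing the square bounds
s in T, and then |x|^2 = c - g is bounded too ([ball_certificate_bounded]). The
bounded elements of a semiring form a subalgebra, so only the bounds of the
finitely many variables matter. Those bounds involve finitely many squares, and
these are the squares of the p_j ([exists_archimedean_squares]).

Part (b). Let S be an Archimedean semiring. A maximal proper S-module is a
half-space, and the linear functional that it defines is a ring morphism to the
reals ([module_character]), that is, evaluation at a point of K. Therefore a
polynomial h > 0 on K satisfies s h - 1 in S for some s in S, and an iteration
that decreases k while h + k stays in S reaches h itself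
([archimedean_positivstellensatz]). The monomials in the generators of S are the
products displayed in (b), once each exponent of an f_i is split into its parity
and an even part.

Part (c). By (b) a functional L as in (c) is nonnegative on every polynomial
positive on K, hence on every polynomial nonnegative on K. The rest is the
theorem of Haviland for a compact set ([haviland_compact]). M. Riesz's argument
extends L to a positive functional Lam on all functions bounded on K
([positive_extension]). Cut K successively by the half-spaces x_i < q with q
rational, and cut the interval [0, L 1) in parallel, giving each cell an interval
of length Lam of its indicator. The cells containing a fixed parameter shrink to
a point of K; the image of Lebesgue measure under this map from parameters to
points is the required measure, because the integral of a polynomial and the
value of Lam on it differ by little on every deep cell ([limit_integral]). A finite
Borel measure that vanishes outside a compact set is a Radon measure
([compact_support_radon]). *)

(** * Prime cones of a commutative ring *)

(** Zorn's lemma for a property [good] of sets which need only be preserved by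
unions of nonempty chains above a given good set [A0]; the empty chain is what
forces the detour through sets [A0 `|` X] in the proof. *)
Lemma Zorn_above (U : Type) (good : set (set U)) (A0 : set U) :
  good A0 ->
  (forall F : set (set U), F !=set0 -> F `<=` good ->
    (forall X, F X -> A0 `<=` X) -> total_on F subset ->
    good (\bigcup_(X in F) X)) ->
  exists A, [/\ A0 `<=` A, good A & forall B, A `<=` B -> good B -> B `<=` A].
Proof.
move=> good0 goodU; pose P X := good (A0 `|` X).
have [F FP Ftot|A [PA Amax]] := @Zorn_bigcup U P.
  have [->|/set0P[X0 FX0]] := eqVneq F set0.
    by rewrite /P bigcup_set0 setU0.
  rewrite /P; have -> : A0 `|` \bigcup_(X in F) X = \bigcup_(X in [set A0 `|` X | X in F]) X.
    apply/seteqP; split=> [x [A0x|[X FX Xx]]|x [_ [X FX <-] [A0x|Xx]]].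
    - by exists (A0 `|` X0); [exists X0|left].
    - by exists (A0 `|` X); [exists X|right].
    - by left.
    - by right; exists X.
  apply: goodU.
  - by exists (A0 `|` X0), X0.
  - by move=> _ [X /FP ? <-].
  - by move=> _ [X _ <-] x; left.
  - move=> _ _ [X FX <-] [Y FY <-].
    by case: (Ftot X Y FX FY) => XY; [left|right]; apply: setUS.
exists (A0 `|` A); split=> [|//|B AB gB]; first exact: subsetUl.
have AB' : A `<=` B by apply: subset_trans AB; apply: subsetUr.
have gB' : P B.
  by rewrite /P (_ : A0 `|` B = B) //; apply/setUidPr/(subset_trans _ AB)/subsetUl.
apply: contrapT => nBA; apply: (Amax B) gB'; split=> // BA.
by apply: nBA; apply: subset_trans BA _; apply: subsetUr.
Qed.

Lemma chain_pair (U : Type) (F : set (set U)) (x y : U) :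
  total_on F subset -> (\bigcup_(X in F) X) x -> (\bigcup_(X in F) X) y ->
  exists Z, [/\ F Z, Z x & Z y].
Proof.
move=> Ftot [X FX Xx] [Y FY Yy].
by case: (Ftot X Y FX FY) => XY; [exists Y|exists X]; split=> //; apply: XY.
Qed.

Section PrimeCones.
Variable A : comNzRingType.

Definition preordering (T : set A) :=
  [/\ forall x y, T x -> T y -> T (x + y),
      forall x y, T x -> T y -> T (x * y) &
      forall x, T (x ^+ 2)].

Definition cone_support (T : set A) : set A := [set x | T x /\ T (- x)].

Record prime_cone (P : set A) : Prop := PrimeCone {
  prime_cone_preordering : preordering P;
  prime_coneN1 : ~ P (-1);
  prime_cone_total : forall x, P x \/ P (- x);
  prime_coneM : forall x y, cone_support P (x * y) ->
    cone_support P x \/ cone_support P y }.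

Lemma preordering0 T : preordering T -> T 0.
Proof. by case=> _ _ /(_ 0); rewrite expr0n. Qed.

Lemma preordering1 T : preordering T -> T 1.
Proof. by case=> _ _ /(_ 1); rewrite expr1n. Qed.

(** A preordering that is maximal without -1 is a prime cone: if neither x nor -x
lay in P, or if x y lay in the support with neither factor in it, adjoining two
elements would write -1 in two ways, and multiplying these two expressions puts
-1 into P. *)
Lemma exists_prime_cone (T : set A) : preordering T -> ~ T (-1) ->
  exists2 P, T `<=` P & prime_cone P.
Proof.
move=> pT TN1.
have [|F F0 FP FT Ftot|P [TP [pP PN1] Pmax]] :=
    @Zorn_above A [set P | preordering P /\ ~ P (-1)] T.
- by split.
- split; last by move=> [X /FP[_ ?]].
  case: F0 => X0 FX0; split=> [x y Fx Fy|x y Fx Fy|x]; last first.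
  + by have [[_ _ sq] _] := FP _ FX0; exists X0.
  + have [Z [FZ Zx Zy]] := chain_pair Ftot Fx Fy; exists Z => //.
    by have [[_ mulZ _] _] := FP _ FZ; apply: mulZ.
  + have [Z [FZ Zx Zy]] := chain_pair Ftot Fx Fy; exists Z => //.
    by have [[addZ _ _] _] := FP _ FZ; apply: addZ.
exists P => //; have [addP mulP sqP] := pP.
have P0 := preordering0 pP; have P1 := preordering1 pP.
(* adjoining an element outside the maximal P puts -1 in the preordering *)
have adjoin a : ~ P a -> exists p q, [/\ P p, P q & -1 = p + q * a].
  move=> Pa; apply: contrapT => none; apply: Pa.
  have sub : P `<=` [set x | exists p q, [/\ P p, P q & x = p + q * a]].
    by move=> p Pp; exists p, 0; rewrite mul0r addr0.
  apply: (Pmax _ sub); last by exists 0, 1; rewrite mul1r add0r.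
  split=> // ; split.
  - move=> _ _ [p [q [Pp Pq ->]]] [p' [q' [Pp' Pq' ->]]].
    by exists (p + p'), (q + q'); split; [exact: addP|exact: addP|ring].
  - move=> _ _ [p [q [Pp Pq ->]]] [p' [q' [Pp' Pq' ->]]].
    exists (p * p' + q * q' * a ^+ 2), (p * q' + p' * q); split; last by ring.
    + by apply: addP; apply: (mulP) => //; apply: mulP.
    + by apply: addP; apply: mulP.
  - by move=> x; apply: sub.
have Ptot x : P x \/ P (- x).
  have [|Px] := pselect (P x); first by left.
  right; apply: contrapT => /adjoin[p' [q' [Pp' Pq' e']]].
  have [p [q [Pp Pq e]]] := adjoin _ Px; apply: PN1.
  have -> : -1 = p + p' + p * p' + q * q' * x ^+ 2.
    have e1 : - 1 - p = q * x by rewrite e; ring.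
    have e2 : - 1 - p' = q' * - x by rewrite e'; ring.
    transitivity ((- 1 - p) * (- 1 - p') - 1 - (q * x) * (q' * - x)).
      by rewrite e1 e2; ring.
    ring.
  by do ?[assumption|apply: (sqP)|apply: (addP)|apply: (mulP)].
split=> // x y [Pxy PNxy].
wlog Px : x Pxy PNxy / ~ P (- x).
  have [Px|Px] := pselect (P x); last first.
    move=> /(_ (- x)); rewrite mulNr !opprK => /(_ PNxy Pxy Px).
    by rewrite /cone_support /= opprK => -[[]|]; [left|right].
  have [PNx _|PNx /(_ x Pxy PNxy PNx)//] := pselect (P (- x)).
  by left.
wlog Py : y Pxy PNxy / ~ P (- y).
  have [Py|Py] := pselect (P y); last first.
    move=> /(_ (- y)); rewrite mulrN !opprK => /(_ PNxy Pxy Py).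
    by rewrite /cone_support /= opprK => -[|[]]; [left|right].
  have [PNy _|PNy /(_ y Pxy PNxy PNy)//] := pselect (P (- y)).
  by right.
have [p [q [Pp Pq e]]] := adjoin _ Px.
have [p' [q' [Pp' Pq' e']]] := adjoin _ Py.
case: PN1.
have -> : -1 = p + p' + p * p' + q * q' * (- (x * y)).
  have e1 : - 1 - p = q * - x by rewrite e; ring.
  have e2 : - 1 - p' = q' * - y by rewrite e'; ring.
  transitivity ((- 1 - p) * (- 1 - p') - 1 - (q * - x) * (q' * - y)).
    by rewrite e1 e2; ring.
  ring.
by do ?[assumption|apply: (sqP)|apply: (addP)|apply: (mulP)].
Qed.

Section Support.
Variables (P : set A) (pP : prime_cone P).

Lemma support0 : cone_support P 0.
Proof.
by have P0 := preordering0 (prime_cone_preordering pP); split; rewrite ?oppr0.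
Qed.

Lemma support1 : ~ cone_support P 1.
Proof. by case=> _; exact: (prime_coneN1 pP). Qed.

Lemma supportD x y : cone_support P x -> cone_support P y -> cone_support P (x + y).
Proof.
have [addP _ _] := prime_cone_preordering pP.
by move=> [Px PNx] [Py PNy]; split; rewrite ?opprD; apply: addP.
Qed.

Lemma supportM a x : cone_support P x -> cone_support P (a * x).
Proof.
have [_ mulP _] := prime_cone_preordering pP.
move=> [Px PNx]; have [Pa|Pa] := prime_cone_total pP a.
  by split; rewrite -?mulrN; apply: mulP.
by split; rewrite -?mulNr -?[a * x]mulrNN; apply: mulP; rewrite ?opprK.
Qed.

End Support.
End PrimeCones.

(** * Maximal cones of a field and the ordered field they define *)

Section FieldCones.
Variable C : fieldType.

(** The nonnegative part of an ordered subring of [C], namely of P - P. Unlike an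
ordering of the field [C] it exists when [C] is algebraically closed. *)
Record field_cone (P : set C) : Prop := FieldCone {
  field_cone1 : P 1;
  field_coneD : forall x y, P x -> P y -> P (x + y);
  field_coneM : forall x y, P x -> P y -> P (x * y);
  field_cone_anti : forall x, P x -> P (- x) -> x = 0;
  field_cone_total : forall x y, P x -> P y -> P (x - y) \/ P (y - x) }.

Lemma field_cone0 P : field_cone P -> P 0.
Proof. by move=> cP; have [] := field_cone_total cP (field_cone1 cP) (field_cone1 cP); rewrite subrr. Qed.

(** The denominator may be 0, with x / 0 = 0; this is harmless because 0 belongs
to every cone. *)
Lemma field_cone_fractions (P : set C) : field_cone P ->
  field_cone [set x / y | x in P & y in P].
Proof.
move=> cP; have [P1 Padd Pmul Panti Ptot] := cP; have P0 := field_cone0 cP.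
split=> [|_ _ [x Px [y Py <-]] [x' Px' [y' Py' <-]]|
          _ _ [x Px [y Py <-]] [x' Px' [y' Py' <-]]|
          _ [x Px [y Py <-]] [x' Px' [y' Py' e]]|
          _ _ [x Px [y Py <-]] [x' Px' [y' Py' <-]]].
- by exists 1 => //; exists 1; rewrite ?divr1.
- have [->|y0] := eqVneq y 0.
    by rewrite invr0 mulr0 add0r; exists x' => //; exists y'.
  have [->|y0'] := eqVneq y' 0.
    by rewrite invr0 mulr0 addr0; exists x => //; exists y.
  exists (x * y' + x' * y); first by apply: Padd; apply: Pmul.
  by exists (y * y'); [exact: Pmul|rewrite addf_div].
- exists (x * x'); first exact: Pmul.
  by exists (y * y'); [exact: Pmul|rewrite mulf_div].
- have [->|y0] := eqVneq y 0; first by rewrite invr0 mulr0.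
  have [y'0|y0'] := eqVneq y' 0.
    by move/eqP: e; rewrite y'0 invr0 mulr0 eq_sym oppr_eq0 => /eqP.
  suff e0 : x * y' = 0.
    by move/eqP: e0; rewrite mulf_eq0 (negPf y0') orbF => /eqP->; rewrite mul0r.
  apply: Panti; first exact: Pmul.
  suff -> : - (x * y') = x' * y by apply: Pmul.
  move/(congr1 (fun z => z * (y * y'))): e.
  by rewrite mulrA mulrAC divfK // mulNr mulrA divfK // => ->.
- have [->|y0] := eqVneq y 0.
    by right; rewrite invr0 mulr0 subr0; exists x' => //; exists y'.
  have [->|y0'] := eqVneq y' 0.
    by left; rewrite invr0 mulr0 subr0; exists x => //; exists y.
  have [h|h] := Ptot _ _ (Pmul _ _ Px Py') (Pmul _ _ Px' Py); [left|right].
    exists (x * y' - x' * y) => //; exists (y * y'); first exact: Pmul.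
    by rewrite -[- (x' / y')]mulNr addf_div // mulNr.
  exists (x' * y - x * y') => //; exists (y' * y); first exact: Pmul.
  by rewrite -[- (x / y)]mulNr addf_div // mulNr.
Qed.

(** Bundling maximality into the type lets the ordered field attached to the cone
carry canonical structures. *)
Record max_field_cone := MaxFieldCone {
  max_cone_set :> C -> Prop;
  max_cone_cone : field_cone max_cone_set;
  max_cone_max : forall Q, max_cone_set `<=` Q -> field_cone Q ->
    Q `<=` max_cone_set }.

Lemma exists_max_field_cone (P0 : set C) : field_cone P0 ->
  exists P : max_field_cone, P0 `<=` max_cone_set P.
Proof.
move=> cP0; have [|F [X0 FX0] FP FT Ftot|P [PP0 cP Pmax]] :=
  @Zorn_above C [set P | field_cone P] P0; [by []| |by exists (MaxFieldCone cP Pmax)].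
have pick x y := @chain_pair _ F x y Ftot.
split=> [|x y Fx Fy|x y Fx Fy|x Fx Fy|x y Fx Fy].
- by exists X0 => //; exact: field_cone1 (FP _ FX0).
- have [Z [FZ Zx Zy]] := pick _ _ Fx Fy; exists Z => //.
  exact: field_coneD (FP _ FZ) _ _ Zx Zy.
- have [Z [FZ Zx Zy]] := pick _ _ Fx Fy; exists Z => //.
  exact: field_coneM (FP _ FZ) _ _ Zx Zy.
- have [Z [FZ Zx Zy]] := pick _ _ Fx Fy.
  exact: field_cone_anti (FP _ FZ) _ Zx Zy.
- have [Z [FZ Zx Zy]] := pick _ _ Fx Fy.
  by have [] := field_cone_total (FP _ FZ) Zx Zy; [left|right]; exists Z.
Qed.

Variable P : max_field_cone.
Let cP : field_cone P := max_cone_cone P.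

(** The fractions of a maximal cone form a cone that contains it, hence lie in it. *)
Lemma max_coneV x : P x -> P x^-1.
Proof.
move=> Px; apply: (max_cone_max (Q := [set x / y | x in P & y in P])).
- by move=> y Py; exists y => //; exists 1; [exact: field_cone1 cP|rewrite divr1].
- exact: field_cone_fractions.
- by exists 1; [exact: field_cone1 cP|exists x => //; rewrite div1r].
Qed.

Definition cone_field_pred : {pred C} := fun x => `[< P x \/ P (- x) >].

Lemma cone_field_predP x : reflect (P x \/ P (- x)) (x \in cone_field_pred).
Proof. by rewrite unfold_in; exact: asboolP. Qed.

Lemma cone_field_closed : divring_closed cone_field_pred.
Proof.
have [P1 Padd Pmul Panti Ptot] := cP; split.
- by apply/cone_field_predP; left.
- move=> x y /cone_field_predP[Px|Px] /cone_field_predP[Py|Py];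
    apply/cone_field_predP.
  + by have [] := Ptot _ _ Px Py; [left|right; rewrite opprB].
  + by left; apply: Padd.
  + by right; rewrite opprB addrC; apply: Padd.
  + by have [] := Ptot _ _ Px Py; rewrite opprK addrC; [right; rewrite opprB|left].
- move=> x y /cone_field_predP Px /cone_field_predP Py.
  have {}Py : P y^-1 \/ P (- y^-1).
    by case: Py => [Py|Py]; [left|right]; rewrite -?invrN; apply: max_coneV.
  apply/cone_field_predP; case: Px Py => [Px|Px] [Py|Py].
  + by left; apply: Pmul.
  + by right; rewrite -mulrN; apply: Pmul.
  + by right; rewrite -mulNr; apply: Pmul.
  + by left; rewrite -mulrNN; apply: Pmul.
Qed.

HB.instance Definition _ :=
  GRing.isDivringClosed.Build C cone_field_pred cone_field_closed.

(** The ordered subfield P `|` -P of [C]; a type of its own, since its order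
depends on the cone. *)
Record cone_field := ConeField {
  cone_field_val : C; cone_field_valP : cone_field_val \in cone_field_pred }.

HB.instance Definition _ := [isSub for cone_field_val].
HB.instance Definition _ := [Choice of cone_field by <:].
HB.instance Definition _ := [SubChoice_isSubIntegralDomain of cone_field by <:].
HB.instance Definition _ := [SubIntegralDomain_isSubField of cone_field by <:].

Definition cf_le (x y : cone_field) := `[< P (val y - val x) >].
Definition cf_lt x y := (y != x) && cf_le x y.
Definition cf_norm x := if cf_le 0 x then x else - x.

Lemma cf_le0P x : reflect (P (val x)) (cf_le 0 x).
Proof. by rewrite /cf_le rmorph0 subr0; exact: asboolP. Qed.

Lemma cf_le0_add x y : cf_le 0 x -> cf_le 0 y -> cf_le 0 (x + y).
Proof.
by move=> /cf_le0P Px /cf_le0P Py; apply/cf_le0P; rewrite rmorphD; apply: field_coneD.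
Qed.
Lemma cf_le0_mul x y : cf_le 0 x -> cf_le 0 y -> cf_le 0 (x * y).
Proof.
by move=> /cf_le0P Px /cf_le0P Py; apply/cf_le0P; rewrite rmorphM; apply: field_coneM.
Qed.
Lemma cf_sub_ge0 x y : cf_le 0 (y - x) = cf_le x y.
Proof. by rewrite /cf_le rmorph0 subr0 rmorphB. Qed.
Lemma cf_le0N x : cf_le x 0 = cf_le 0 (- x).
Proof. by rewrite -cf_sub_ge0 sub0r. Qed.
Lemma cf_le0_anti x : cf_le 0 x -> cf_le x 0 -> x = 0.
Proof.
rewrite cf_le0N => /cf_le0P Px /cf_le0P; rewrite rmorphN => PNx.
by apply: val_inj; rewrite rmorph0; apply: field_cone_anti PNx.
Qed.
Lemma cf_le0_total x : cf_le 0 x || cf_le x 0.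
Proof.
rewrite cf_le0N; have /cone_field_predP[Px|Px] := cone_field_valP x.
  by apply/orP; left; apply/cf_le0P.
by apply/orP; right; apply/cf_le0P; rewrite rmorphN.
Qed.
Lemma cf_normN x : cf_norm (- x) = cf_norm x.
Proof.
rewrite /cf_norm opprK; case: ifPn => h; case: ifPn => h' //.
  by rewrite (cf_le0_anti h' _) ?oppr0 // cf_le0N.
by have := cf_le0_total x; rewrite cf_le0N (negPf h) (negPf h').
Qed.
Lemma cf_ge0_norm x : cf_le 0 x -> cf_norm x = x.
Proof. by rewrite /cf_norm => ->. Qed.
Lemma cf_lt_def x y : cf_lt x y = (y != x) && cf_le x y.
Proof. by []. Qed.

HB.instance Definition _ := Num.IntegralDomain_isLeReal.Build cone_field
  cf_le0_add cf_le0_mul cf_le0_anti cf_sub_ge0 cf_le0_total cf_normN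
  cf_ge0_norm cf_lt_def.

Lemma cone_field_ge0 (x : cone_field) : reflect (P (val x)) (0 <= x).
Proof. exact: cf_le0P. Qed.

End FieldCones.

(** * Maximal cones of an algebraically closed field give real closed fields *)

Section WeightedSums.
Variable F : realFieldType.

(** The weights are needed because the nonnegative elements of [F] are not yet
known to be squares. *)
Inductive weighted_sos : {poly F} -> Prop :=
| WSos0 : weighted_sos 0
| WSosD (c : F) (g s : {poly F}) of 0 <= c & weighted_sos s : weighted_sos (c *: g ^+ 2 + s).

Lemma wsosD s t : weighted_sos s -> weighted_sos t -> weighted_sos (s + t).
Proof.
move=> Hs Ht; elim: Hs => [|c g u c0 _ IH]; first by rewrite add0r.
by rewrite -addrA; constructor.
Qed.

Lemma wsos_sqr c g : 0 <= c -> weighted_sos (c *: g ^+ 2).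
Proof. by move=> c0; rewrite -[_ *: _]addr0; constructor => //; constructor. Qed.

Lemma wsosM s t : weighted_sos s -> weighted_sos t -> weighted_sos (s * t).
Proof.
move=> Hs Ht; elim: Hs => [|c g u c0 _ IH]; first by rewrite mul0r; constructor.
rewrite mulrDl; apply: wsosD IH.
elim: Ht => [|c' g' u' c0' _ IH]; first by rewrite mulr0; constructor.
rewrite mulrDr -scalerAl -scalerAr scalerA -exprMn.
by apply: wsosD IH; apply: wsos_sqr; rewrite mulr_ge0.
Qed.

Lemma wsos_ge0 s x : weighted_sos s -> 0 <= s.[x].
Proof.
elim=> [|c g u c0 _ IH]; first by rewrite horner0.
by rewrite hornerD hornerZ horner_exp addr_ge0 // mulr_ge0 // sqr_ge0.
Qed.

(** Reduce every polynomial that is squared modulo p. *)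
Lemma wsos_mod (p s : {poly F}) : (1 < size p)%N -> weighted_sos s ->
  exists s', [/\ weighted_sos s', p %| (s - s') & (size s' <= size p + size p - 3)%N].
Proof.
move=> p1; have p0 : p != 0 by rewrite -size_poly_gt0 ltnW.
elim=> [|c g u c0 _ [u' [Hu' pu su]]].
  by exists 0; split; [constructor|rewrite subr0 dvdp0|rewrite size_poly0].
exists (c *: (g %% p) ^+ 2 + u'); split; first by constructor.
  rewrite opprD addrACA dvdp_add // -scalerBr -mul_polyC subr_sqr.
  by rewrite dvdp_mull // dvdp_mulr // {1}(divp_eq g p) addrK dvdp_mull.
rewrite (leq_trans (size_polyD _ _)) // geq_max su andbT.
rewrite (leq_trans (size_scale_leq _ _)) // expr2 (leq_trans (size_polyMleq _ _)) //.
have : (size (g %% p)%R < size p)%N by rewrite ltn_modp.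
by move: (size _) (size p) p1 => m n; lia.
Qed.

(** This keeps -1 from being a weighted sum of squares modulo p. With the squares
reduced modulo p, the cofactor h has smaller degree than p, and p h > 0 everywhere
shows that h changes sign wherever p does; so h takes over the role of p, and the
degrees descend for ever. *)
Lemma sign_change_not_neg_sos (a b : F) (p h s : {poly F}) :
  p.[a] * p.[b] < 0 -> weighted_sos s -> p * h != 1 + s.
Proof.
have [n] := ubnP (size p); elim: n p h s => // n IH p h s pn pab Hs.
apply/eqP => e.
have p1 : (1 < size p)%N.
  rewrite ltnNge; apply/negP => /size1_polyC pC.
  by move: pab; rewrite pC !hornerC ltNge -expr2 sqr_ge0.
have [s' [Hs' ps sz]] := wsos_mod p1 Hs.
have [h' e'] : exists h', p * h' = 1 + s'.
  have /dvdpP[k hk] := ps; exists (h - k).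
  by rewrite mulrBr e [p * k]mulrC -hk; ring.
have hab x : p.[x] * h'.[x] = 1 + s'.[x] by rewrite -hornerM e' hornerD hornerC.
have pos x : 0 < p.[x] * h'.[x].
  by rewrite hab ltr_pwDl // wsos_ge0.
have h'ab : h'.[a] * h'.[b] < 0.
  have := mulr_gt0 (pos a) (pos b).
  by rewrite mulrACA nmulr_rgt0.
have p0 : p != 0 by rewrite -size_poly_gt0 ltnW.
have h0 : h' != 0 by apply: contraTneq h'ab => ->; rewrite !horner0 mulr0 ltxx.
have szh : (size h' < size p)%N.
  have := congr1 (fun q : {poly F} => size q) e'; rewrite size_mul //.
  have := size_polyD 1 s'; rewrite size_poly1 => sz1 sz2.
  have h1 : (0 < size h')%N by rewrite size_poly_gt0.
  move: sz1 sz p1 h1; rewrite -sz2; move: (size s') (size p) (size h') => x y z.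
  by lia.
have := IH h' p s' (leq_trans szh pn) h'ab Hs'.
by rewrite mulrC e' eqxx.
Qed.
End WeightedSums.

Section RealClosed.
Variables (C : closedFieldType) (P : max_field_cone C).
Local Notation F := (cone_field P).

Let v : {rmorphism F -> C} := GRing.RMorphism.clone _ _ (val : F -> C) _.
Let ev (z : C) : {rmorphism {poly F} -> C} := horner_eval z \o map_poly v.

(** Since -1 is not a sum of squares modulo p, there is a prime cone of [{poly F}]
whose support contains p. Its support is generated by a nonconstant q, and
evaluation at a root z of q in the algebraically closed field maps the prime cone
onto a cone containing P. By maximality this cone is P, so z or -z lies in P:
the root z of p belongs to [F]. *)
Lemma sign_change_root (a b : F) (p : {poly F}) :
  p.[a] * p.[b] < 0 -> exists z : F, root p z.
Proof.
move=> pab.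
pose T : set {poly F} := [set g | exists s h, weighted_sos s /\ g = s + p * h].
have pT : preordering T.
  split=> [_ _ [s [h [Hs ->]]] [s' [h' [Hs' ->]]]
          |_ _ [s [h [Hs ->]]] [s' [h' [Hs' ->]]]|g].
  - by exists (s + s'), (h + h'); split; [exact: wsosD|ring].
  - exists (s * s'), (h * (s' + p * h') + s * h'); split; [exact: wsosM|ring].
  - exists (g ^+ 2), 0; split; last by rewrite mulr0 addr0.
    by rewrite -[g ^+ 2]scale1r; apply: wsos_sqr.
have TN1 : ~ T (-1).
  move=> [s [h [Hs e]]]; have /eqP := sign_change_not_neg_sos (- h) pab Hs; apply.
  by rewrite mulrN; apply/eqP; rewrite eqr_oppLR opprD; apply/eqP; rewrite {1}e; ring.
have [P1 TP1 pP1] := exists_prime_cone pT TN1.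
have [addP1 mulP1 sqP1] := prime_cone_preordering pP1.
have sp : cone_support P1 p.
  split; apply: TP1; exists 0; [exists 1|exists (-1)]; (split; first by constructor).
    by rewrite mulr1 add0r.
  by rewrite mulrN1 add0r.
have p0 : p != 0 by apply: contraTneq pab => ->; rewrite !horner0 mulr0 ltxx.
(* q is a nonzero element of least degree in the support *)
pose deg := [pred n | `[< exists q, [/\ cone_support P1 q, q != 0 & size q = n] >]].
have [|n /asboolP[q [sq q0 qn]] nmin] := @ex_minnP deg.
  by exists (size p); apply/asboolP; exists p.
have qmin g : cone_support P1 g -> g != 0 -> (size q <= size g)%N.
  by move=> sg g0; rewrite qn nmin //; apply/asboolP; exists g.
have q_dvd g : cone_support P1 g -> q %| g.
  move=> sg; apply/modp_eq0P; apply: contrapT => /eqP gq0.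
  have : (size (g %% q)%R < size q)%N by rewrite ltn_modp.
  rewrite ltnNge qmin //.
  have -> : g %% q = g + (- (g %/ q)) * q.
    by rewrite {2}(divp_eq g q); ring.
  by apply: supportD => //; apply: supportM.
have q1 : (1 < size q)%N.
  rewrite ltnNge; apply/negP => q1.
  have /size_poly1P[c c0 qc] : size q == 1%N by rewrite eqn_leq q1 size_poly_gt0.
  apply: (support1 pP1); rewrite (_ : 1 = c^-1%:P * q); first exact: supportM.
  by rewrite qc -polyCM mulVf.
have [z /rootP qz] : exists z, root (map_poly v q) z.
  by apply/closed_rootP; rewrite size_map_poly gtn_eqF.
have evE g : ev z g = (map_poly v g).[z] by [].
have evq : ev z q = 0 by rewrite evE.
have evC c : ev z c%:P = val c by rewrite evE map_polyC hornerC.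
have support_ev g : cone_support P1 g -> ev z g = 0.
  by move=> /q_dvd/dvdpP[k ->]; rewrite rmorphM evq mulr0.
(* the gcd of g and q vanishes at z, so it is not constant; primality of the
     support and minimality of q then put it, and with it g, in the support *)
have ev_support g : ev z g = 0 -> cone_support P1 g.
  move=> evg; have [->|g0] := eqVneq g 0; first exact: support0.
  pose m := gcdp g q.
  have evm : ev z m = 0.
    rewrite /m; have [u /andP[/dvdpP[k ->] _]] := Bezoutp g q.
    by rewrite rmorphM rmorphD !rmorphM evg evq !mulr0 addr0 mulr0.
  have m0 : m != 0 by rewrite gcdp_eq0 (negPf g0).
  have /dvdpP[k hk] : m %| q by exact: dvdp_gcdr.
  have sm : cone_support P1 m.
    have [|sk|//] := prime_coneM pP1 (x := k) (y := m); first by rewrite -hk.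
    have k0 : k != 0 by apply: contraTneq q0 => k0; rewrite hk k0 mul0r eqxx.
    have := qmin _ sk k0; rewrite {1}hk size_mul // => sz.
    have /size_poly1P[c c0 mc] : size m == 1%N.
      have : (0 < size m)%N by rewrite size_poly_gt0.
      have : (0 < size k)%N by rewrite size_poly_gt0.
      by move: sz; move: (size m) (size k) => x y; lia.
    by move: evm; rewrite mc evC => /eqP; rewrite fmorph_eq0 (negPf c0).
  have /dvdpP[l ->] : m %| g by exact: dvdp_gcdl.
  exact: supportM.
pose Q : set C := ev z @` P1.
have cQ : field_cone Q.
  split.
  - by exists 1; [exact: preordering1 (prime_cone_preordering pP1)|rewrite rmorph1].
  - move=> _ _ [g Pg <-] [h Ph <-]; exists (g + h); first exact: addP1.
    by rewrite rmorphD.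
  - move=> _ _ [g Pg <-] [h Ph <-]; exists (g * h); first exact: mulP1.
    by rewrite rmorphM.
  - move=> _ [g Pg <-] [h Ph e].
    have /ev_support s : ev z (g + h) = 0 by rewrite rmorphD e subrr.
    apply: support_ev; split=> //.
    have -> : - g = h + (- (g + h)) by ring.
    by apply: addP1 => //; case: s.
  - move=> _ _ [g Pg <-] [h Ph <-].
    have [?|] := prime_cone_total pP1 (g - h); [left|rewrite opprB=> ?; right].
      by exists (g - h); rewrite ?rmorphB.
    by exists (h - g); rewrite ?rmorphB.
have PQ : max_cone_set P `<=` Q.
  move=> x Px; have xin : x \in cone_field_pred P by apply/cone_field_predP; left.
  pose X : F := ConeField xin; exists X%:P; last by rewrite evC.
  apply: TP1; exists X%:P, 0; split; last by rewrite mulr0 addr0.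
  rewrite -[X%:P]mulr1 mul_polyC -[1](expr1n _ 2); apply: wsos_sqr.
  by apply/cone_field_ge0.
have /(_ _ _)QP := max_cone_max PQ cQ.
have evX : ev z 'X = z by rewrite evE map_polyX hornerX.
have zin : z \in cone_field_pred P.
  apply/cone_field_predP; have [PX|PX] := prime_cone_total pP1 'X; [left|right];
    apply: QP.
    by exists 'X.
  by exists (- 'X) => //; rewrite rmorphN evX.
exists (ConeField zin); apply/rootP/val_inj.
by rewrite rmorph0 -(support_ev _ sp) evE -[z]/(v (ConeField zin)) horner_map.
Qed.

(** A root outside [a, b] can be divided out without affecting the sign change. *)
Lemma cone_field_ivt : Num.real_closed_axiom F.
Proof.
move=> p a b ab /andP[].
rewrite le_eqVlt => /predU1P[pa _|pa]; first by exists a; rewrite ?lexx ?ab //; apply/rootP.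
rewrite le_eqVlt => /predU1P[pb|pb]; first by exists b; rewrite ?lexx ?ab //; apply/rootP.
have : p.[a] * p.[b] < 0 by rewrite nmulr_rlt0.
have [n] := ubnP (size p); elim: n p {pa pb} => // n IH p pn pab.
have [z pz] := sign_change_root pab.
have [zab|] := boolP (a <= z <= b); first by exists z.
move=> zab; have /factor_theorem[q pq] := pz.
have p0 : p != 0 by apply: contraTneq pab => ->; rewrite !horner0 mulr0 ltxx.
have q0 : q != 0 by apply: contraNneq p0 => q0; rewrite pq q0 mul0r.
have szq : (size q < n)%N.
  by move: pn; rewrite pq size_Mmonic ?monicXsubC // size_XsubC addn2 ltnS.
have qab : q.[a] * q.[b] < 0.
  have pos : 0 < (a - z) * (b - z).
    by move: zab; rewrite negb_and -!ltNge => /orP[h|h]; nra.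
  move: pab; rewrite pq !hornerM !hornerXsubC mulrACA [X in X < 0]mulrC.
  by rewrite pmulr_rlt0.
have [x xab qx] := IH q szq qab.
by exists x => //; rewrite pq rootM qx.
Qed.

HB.instance Definition _ := Num.RealField_isClosed.Build F cone_field_ivt.
End RealClosed.

(** * Prime cones as pullbacks of the order of a real closed field *)

Section DomainUnits.
Variables (D : comNzRingType).

Definition some_unit : pred D := fun x => `[< exists y, y * x = 1 >].
(** Inverses chosen classically: they provide the unit ring structure which an
integral domain is required to carry. *)
Definition some_inv (x : D) : D :=
  if pselect (exists y, y * x = 1) is left h then projT1 (cid h) else x.

Lemma some_mulVr : {in some_unit, left_inverse 1 some_inv *%R}.
Proof.
move=> x /asboolP h; rewrite /some_inv; case: pselect => // h'.
by case: cid.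
Qed.

Lemma some_unitPl (x y : D) : y * x = 1 -> some_unit x.
Proof. by move=> e; apply/asboolP; exists y. Qed.

Lemma some_inv_out : {in [predC some_unit], some_inv =1 id}.
Proof.
move=> x /negP h; rewrite /some_inv; case: pselect => // h'.
by case: h; apply/asboolP.
Qed.
End DomainUnits.

Lemma fraction_numden (D : idomainType) (x : {fraction D}) :
  exists n d : D, x = FracField.tofrac n / FracField.tofrac d.
Proof.
elim/quotW: x => r; exists (frac r).1, (frac r).2.
have d0 : FracField.tofrac (frac r).2 != 0 by rewrite tofrac_eq0 denom_ratioP.
apply: (mulIf d0); rewrite divfK //; unlock FracField.tofrac.
rewrite -[LHS]FracField.pi_mul; apply/eqmodP; rewrite /= FracField.equivfE.
rewrite /FracField.mulf !numden_Ratio ?mulf_neq0 ?denom_ratioP ?oner_neq0 //.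
by rewrite !mulr1 mulrC.
Qed.

Section ConeQuotient.
Local Open Scope quotient_scope.
Variables (A : comNzRingType) (P : set A) (pP : prime_cone P).

Definition support_pred : {pred A} := fun a => `[< cone_support P a >].

Lemma support_predP a : reflect (cone_support P a) (a \in support_pred).
Proof. exact: asboolP. Qed.

Lemma support_idealr : idealr_closed support_pred.
Proof.
split; first by apply/support_predP; exact: support0.
- by apply/support_predP; exact: support1.
- move=> a u v /support_predP su /support_predP sv; apply/support_predP.
  by apply: supportD => //; apply: supportM.
Qed.

Lemma support_prime : prime_idealr_closed support_pred.
Proof.
move=> u v /support_predP /(prime_coneM pP)[s|s]; apply/orP; [left|right];
  exact/support_predP.
Qed.

(** The support of a prime cone is a prime ideal, so the quotient by it is an
integral domain. *)
Lemma support_quotient : exists (D : idomainType) (f : {rmorphism A -> D}),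
  (forall d, exists a, f a = d) /\ forall a, f a = 0 <-> cone_support P a.
Proof.
pose I : prime_idealr A := HB.pack support_pred
  (isIdealr.Build A support_pred support_idealr)
  (isPrimeIdealrClosed.Build A support_pred support_prime).
have [D0 [f [f_surj f0 D0_int]]] : exists (D0 : comNzRingType) (f : {rmorphism A -> D0}),
    [/\ forall d, exists a, f a = d, forall a, f a = 0 <-> cone_support P a &
      forall x y : D0, x * y = 0 -> (x == 0) || (y == 0)].
  exists {ideal_quot I}, \pi_({ideal_quot I}); split.
  - by move=> d; exists (repr d); exact: reprK.
  - move=> a; pose f : {rmorphism A -> {ideal_quot I}} := \pi_({ideal_quot I}).
    have e : (f a == f 0) = (a \in support_pred).
      by rewrite -[in RHS](subr0 a) (Quotient.idealrBE I).
    by rewrite -[X in X = 0]/(f a) (rwP (support_predP a)) -e rmorph0; split=> /eqP.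
  - exact: Quotient.rquot_IdomainAxiom.
pose D1 : comUnitRingType := HB.pack D0 (GRing.ComNzRing_hasMulInverse.Build D0
  (@some_mulVr D0) (@some_unitPl D0) (@some_inv_out D0)).
pose D : idomainType := HB.pack D1 (GRing.ComUnitRing_isIntegral.Build D1 D0_int).
by exists D, f.
Qed.

(** The algebraic closure of the fraction field of the quotient by the support. The
enumeration makes the fraction field countable, and adjoining roots of one
polynomial after another then constructs its algebraic closure. *)
Lemma prime_cone_in_closed_field (enum : nat -> A) :
  (forall a, exists i, enum i = a) ->
  exists (C : closedFieldType) (psi : {rmorphism A -> C}),
    forall a, psi a = 0 <-> cone_support P a.
Proof.
move=> enumP; have [D [f [f_surj f0]]] := support_quotient.
have [K [q [q0 frac]]] : exists (K : fieldType) (q : {rmorphism A -> K}),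
    (forall a, q a = 0 <-> cone_support P a) /\
    forall x, exists ij : nat * nat, q (enum ij.1) / q (enum ij.2) = x.
  exists {fraction D}, (@FracField.tofrac D \o f); split=> [a|x].
    by rewrite -f0 /=; split=> /eqP; rewrite ?tofrac_eq0 => h; apply/eqP;
      rewrite ?tofrac_eq0.
  have [n [d ->]] := fraction_numden x.
  have [[a fa] [b fb]] := (f_surj n, f_surj d).
  have [[i ei] [j ej]] := (enumP a, enumP b).
  by exists (i, j); rewrite /= ei ej fa fb.
pose code (x : K) : nat * nat := projT1 (cid (frac x)).
have codeK : cancel code (fun ij => q (enum ij.1) / q (enum ij.2)).
  by move=> x; rewrite /code; case: cid.
pose Kc : countFieldType :=
  HB.pack K (isCountable.Build K (pcan_pickleK (can_pcan codeK))).
have [C [toC _]] := countable_algebraic_closure Kc.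
exists C, (toC \o (q : {rmorphism A -> Kc})) => a; rewrite -q0.
have h : (toC (q a) == 0) = (q a == 0) := fmorph_eq0 toC (q a).
by split=> /eqP; [rewrite h|rewrite -h] => /eqP.
Qed.

(** The image of P in an algebraically closed field is a cone; a maximal cone above
it defines a real closed field that contains the image of [A]. No new element of
[A] becomes nonnegative because a is nonnegative or -a is, already in P. *)
Lemma prime_cone_real_closed (enum : nat -> A) :
  (forall a, exists i, enum i = a) ->
  exists (F : rcfType) (phi : {rmorphism A -> F}), forall a, P a <-> 0 <= phi a.
Proof.
move=> /prime_cone_in_closed_field[C [psi psi0]].
have [addP mulP sqP] := prime_cone_preordering pP.
have cP : field_cone (psi @` P).
  split.
  - by exists 1; [exact: preordering1 (prime_cone_preordering pP)|rewrite rmorph1].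
  - move=> _ _ [g Pg <-] [h Ph <-]; exists (g + h); first exact: addP.
    by rewrite rmorphD.
  - move=> _ _ [g Pg <-] [h Ph <-]; exists (g * h); first exact: mulP.
    by rewrite rmorphM.
  - move=> _ [g Pg <-] [h Ph e].
    have /psi0 s : psi (g + h) = 0 by rewrite rmorphD e subrr.
    apply/psi0; split=> //.
    have -> : - g = h + (- (g + h)) by ring.
    by apply: addP => //; case: s.
  - move=> _ _ [g Pg <-] [h Ph <-].
    have [?|] := prime_cone_total pP (g - h); [left|rewrite opprB=> ?; right].
      by exists (g - h); rewrite ?rmorphB.
    by exists (h - g); rewrite ?rmorphB.
have [Q PQ] := exists_max_field_cone cP.
have inQ a : psi a \in cone_field_pred Q.
  apply/cone_field_predP; have [Pa|Pa] := prime_cone_total pP a; [left|right].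
    by apply: PQ; exists a.
  by apply: PQ; exists (- a); rewrite ?rmorphN.
pose phi a : cone_field Q := ConeField (inQ a).
have phiB : zmod_morphism phi.
  by move=> a b; apply: val_inj; rewrite [RHS]rmorphB /= rmorphB.
have phiM : monoid_morphism phi.
  split=> [|a b]; apply: val_inj; first by rewrite rmorph1 /= rmorph1.
  by rewrite [RHS]rmorphM /= rmorphM.
pose phiR : {rmorphism A -> cone_field Q} := HB.pack phi
  (GRing.isZmodMorphism.Build A (cone_field Q) phi phiB)
  (GRing.isMonoidMorphism.Build A (cone_field Q) phi phiM).
exists (cone_field Q), phiR => a; split=> [Pa|/cone_field_ge0/= Qa].
  by apply/cone_field_ge0/PQ; exists a.
have [//|PNa] := prime_cone_total pP a.
have QNa : max_cone_set Q (- psi a) by apply: PQ; exists (- a); rewrite ?rmorphN.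
have /psi0[//] := field_cone_anti (max_cone_cone Q) Qa QNa.
Qed.

End ConeQuotient.

(** * Quantifier elimination formulas under change of the field of constants *)

(** The quantifier elimination procedure works with terms whose constants lie in a
fixed real closed field. It is run here over the rationals, and the resulting
formula is used over every real closed field at once; [tmap] and [fmap] change the
field of constants. *)
Fixpoint tmap (F G : Type) (phi : F -> G) (t : qe_rcf.term F) : qe_rcf.term G :=
  match t with
  | qe_rcf.Var i => qe_rcf.Var G i
  | qe_rcf.Const c => qe_rcf.Const (phi c)
  | qe_rcf.NatConst n => qe_rcf.NatConst G n
  | qe_rcf.Add u v => qe_rcf.Add (tmap phi u) (tmap phi v)
  | qe_rcf.Opp u => qe_rcf.Opp (tmap phi u)
  | qe_rcf.NatMul u n => qe_rcf.NatMul (tmap phi u) n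
  | qe_rcf.Mul u v => qe_rcf.Mul (tmap phi u) (tmap phi v)
  | qe_rcf.Exp u n => qe_rcf.Exp (tmap phi u) n
  end.

Fixpoint fmap (F G : Type) (phi : F -> G) (f : qe_rcf.formula F) :
    qe_rcf.formula G :=
  match f with
  | qe_rcf.Bool b => qe_rcf.Bool b
  | qe_rcf.Equal u v => qe_rcf.Equal (tmap phi u) (tmap phi v)
  | qe_rcf.Lt u v => qe_rcf.Lt (tmap phi u) (tmap phi v)
  | qe_rcf.Le u v => qe_rcf.Le (tmap phi u) (tmap phi v)
  | qe_rcf.And f g => qe_rcf.And (fmap phi f) (fmap phi g)
  | qe_rcf.Or f g => qe_rcf.Or (fmap phi f) (fmap phi g)
  | qe_rcf.Implies f g => qe_rcf.Implies (fmap phi f) (fmap phi g)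
  | qe_rcf.Not f => qe_rcf.Not (fmap phi f)
  end.

(** The procedure never inspects the constants of its terms, hence it commutes with
a change of constants. It is written in continuation-passing style, so each
statement assumes that the continuations k and k' correspond and concludes that
the formulas built from them do. The only constants that it introduces are
rational numbers, which a ring morphism preserves ([rmorph_coefs]). *)
Section Naturality.
Variables (F G : realFieldType) (phi : {rmorphism F -> G}).
Local Notation tF := (qe_rcf.term F).
Local Notation pF := (seq (qe_rcf.term F)).
Local Notation tm := (tmap phi).
Local Notation pm := (map (tmap phi)).
Local Notation fm := (fmap phi).

Lemma fmap_If f g h : fm (qe_rcf.If f g h) = qe_rcf.If (fm f) (fm g) (fm h).
Proof. by []. Qed.

Lemma fmap_Size p k k' : (forall n, fm (k n) = k' n) ->
  fm (qe_rcf.Size p k) = qe_rcf.Size (pm p) k'.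
Proof.
elim: p k k' => [|c p IH] k k' H //=.
by apply: IH => -[|n] //=; rewrite !H.
Qed.

Lemma fmap_Isnull p k k' : (forall n, fm (k n) = k' n) ->
  fm (qe_rcf.Isnull p k) = qe_rcf.Isnull (pm p) k'.
Proof. by move=> H; apply: fmap_Size => n. Qed.

Lemma fmap_LtSize p q k k' : (forall n, fm (k n) = k' n) ->
  fm (qe_rcf.LtSize p q k) = qe_rcf.LtSize (pm p) (pm q) k'.
Proof. by move=> H; apply: fmap_Size => n; apply: fmap_Size. Qed.

Lemma fmap_LeadCoef p k k' : (forall t, fm (k t) = k' (tm t)) ->
  fm (qe_rcf.LeadCoef p k) = qe_rcf.LeadCoef (pm p) k'.
Proof.
elim: p k k' => [|c p IH] k k' H /=; first by rewrite H /= rmorph0.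
by apply: IH => t /=; rewrite !H.
Qed.

Lemma tmap_AmulXn a n : pm (qe_rcf.AmulXn a n) = qe_rcf.AmulXn (tm a) n.
Proof. by elim: n => //= n ->; rewrite rmorph0. Qed.

Lemma tmap_AddPoly p q :
  pm (qe_rcf.AddPoly p q) = qe_rcf.AddPoly (pm p) (pm q).
Proof. by elim: p q => //= a p IH [|b q] //=; rewrite IH. Qed.

Lemma tmap_ScalPoly c p :
  pm (qe_rcf.ScalPoly c p) = qe_rcf.ScalPoly (tm c) (pm p).
Proof. by rewrite /qe_rcf.ScalPoly -!map_comp. Qed.

Lemma tmap_MulPoly p q :
  pm (qe_rcf.MulPoly p q) = qe_rcf.MulPoly (pm p) (pm q).
Proof. by elim: p => //= a p IH; rewrite tmap_AddPoly tmap_ScalPoly /= IH. Qed.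

Lemma tmap_ExpPoly p n :
  pm (qe_rcf.ExpPoly p n) = qe_rcf.ExpPoly (pm p) n.
Proof.
rewrite /qe_rcf.ExpPoly; case: n => //= n.
by elim: n => //= n IH; rewrite tmap_MulPoly IH.
Qed.

Lemma tmap_OppPoly p : pm (qe_rcf.OppPoly p) = qe_rcf.OppPoly (pm p).
Proof. by rewrite /qe_rcf.OppPoly tmap_ScalPoly /= rmorphN rmorph1. Qed.

Lemma tmap_Deriv p : pm (qe_rcf.Deriv p) = qe_rcf.Deriv (pm p).
Proof. by elim: p => //= a p IH; rewrite tmap_AddPoly /= IH. Qed.

Definition trip (d : nat * pF * pF) := (d.1.1, pm d.1.2, pm d.2).

Lemma fmap_Rediv_rec_loop q sq cq c qq r n k k' :
  (forall d, fm (k d) = k' (trip d)) ->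
  fm (qe_rcf.Rediv_rec_loop q sq cq c qq r n k) =
  qe_rcf.Rediv_rec_loop (pm q) sq (tm cq) c (pm qq) (pm r) n k'.
Proof.
move=> H; elim: n c qq r => [|n IH] c qq r /=; apply: fmap_Size => sr;
  case: ifP => _; rewrite ?H //; apply: fmap_LeadCoef => lr.
  rewrite H /trip /= !(tmap_AddPoly, tmap_MulPoly, tmap_OppPoly, tmap_AmulXn).
  by [].
rewrite IH !(tmap_AddPoly, tmap_MulPoly, tmap_OppPoly, tmap_AmulXn).
by [].
Qed.

Lemma fmap_Rediv p q k k' : (forall d, fm (k d) = k' (trip d)) ->
  fm (qe_rcf.Rediv p q k) = qe_rcf.Rediv (pm p) (pm q) k'.
Proof.
move=> H; apply: fmap_Isnull => -[]; first by rewrite H /trip /= rmorph0.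
apply: fmap_Size => sq; apply: fmap_Size => sp; apply: fmap_LeadCoef => lq.
by rewrite (fmap_Rediv_rec_loop _ _ _ _ _ _ _ H) /= rmorph0.
Qed.

Lemma fmap_Rmod p q k k' : (forall r, fm (k r) = k' (pm r)) ->
  fm (qe_rcf.Rmod p q k) = qe_rcf.Rmod (pm p) (pm q) k'.
Proof. by move=> H; apply: fmap_Rediv => d; rewrite H. Qed.

Lemma fmap_Rscal p q k k' : (forall r, fm (k r) = k' r) ->
  fm (qe_rcf.Rscal p q k) = qe_rcf.Rscal (pm p) (pm q) k'.
Proof. by move=> H; apply: fmap_Rediv => d; rewrite H. Qed.

Lemma fmap_Rgcd_loop n p q k k' : (forall r, fm (k r) = k' (pm r)) ->
  fm (qe_rcf.Rgcd_loop n p q k) = qe_rcf.Rgcd_loop n (pm p) (pm q) k'.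
Proof.
move=> H; elim: n p q => [|n IH] p q /=; apply: fmap_Rmod => r;
  by apply: fmap_Isnull => -[].
Qed.

Lemma fmap_Rgcd p q k k' : (forall r, fm (k r) = k' (pm r)) ->
  fm (qe_rcf.Rgcd p q k) = qe_rcf.Rgcd (pm p) (pm q) k'.
Proof.
move=> H; apply: fmap_LtSize => -[]; apply: fmap_Isnull => -[] //;
  by apply: fmap_Size => n; apply: fmap_Rgcd_loop.
Qed.

Lemma fmap_BigRgcd ps k k' : (forall r, fm (k r) = k' (pm r)) ->
  fm (qe_rcf.BigRgcd ps k) = qe_rcf.BigRgcd (map pm ps) k'.
Proof.
elim: ps k k' => [|p ps IH] k k' H /=; first by rewrite H /= rmorph0.
by apply: IH => r; apply: fmap_Rgcd.
Qed.

Lemma fmap_Changes s k k' : (forall n, fm (k n) = k' n) ->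
  fm (qe_rcf.Changes s k) = qe_rcf.Changes (pm s) k'.
Proof.
elim: s k k' => [|a s IH] k k' H //=.
apply: IH => n; rewrite fmap_If /= !H.
by case: s.
Qed.

Lemma fmap_SeqPInfty ps k k' : (forall s, fm (k s) = k' (pm s)) ->
  fm (qe_rcf.SeqPInfty ps k) = qe_rcf.SeqPInfty (map pm ps) k'.
Proof.
elim: ps k k' => [|p ps IH] k k' H /=; first by rewrite H.
by apply: fmap_LeadCoef => lp; apply: IH => s; rewrite H.
Qed.

Lemma fmap_SeqMInfty ps k k' : (forall s, fm (k s) = k' (pm s)) ->
  fm (qe_rcf.SeqMInfty ps k) = qe_rcf.SeqMInfty (map pm ps) k'.
Proof.
elim: ps k k' => [|p ps IH] k k' H /=; first by rewrite H.
apply: fmap_LeadCoef => lp; apply: fmap_Size => sp; apply: IH => s.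
by rewrite H /= rmorphN rmorph1.
Qed.

Lemma fmap_ChangesPoly ps k k' : (forall n, fm (k n) = k' n) ->
  fm (qe_rcf.ChangesPoly ps k) = qe_rcf.ChangesPoly (map pm ps) k'.
Proof.
move=> H; apply: fmap_SeqMInfty => s; apply: fmap_SeqPInfty => s'.
by apply: fmap_Changes => m; apply: fmap_Changes.
Qed.

Lemma fmap_NextMod p q k k' : (forall r, fm (k r) = k' (pm r)) ->
  fm (qe_rcf.NextMod p q k) = qe_rcf.NextMod (pm p) (pm q) k'.
Proof.
move=> H; apply: fmap_LeadCoef => lq; apply: fmap_Rscal => n.
by apply: fmap_Rmod => r; rewrite H tmap_ScalPoly.
Qed.

Lemma fmap_ModsAux p q n k k' : (forall s, fm (k s) = k' (map pm s)) ->
  fm (qe_rcf.ModsAux p q n k) = qe_rcf.ModsAux (pm p) (pm q) n k'.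
Proof.
elim: n p q k k' => [|n IH] p q k k' H /=; first by rewrite H.
apply: fmap_Isnull => -[]; first by rewrite H.
by apply: fmap_NextMod => r; apply: IH => s; rewrite H.
Qed.

Lemma fmap_Mods p q k k' : (forall s, fm (k s) = k' (map pm s)) ->
  fm (qe_rcf.Mods p q k) = qe_rcf.Mods (pm p) (pm q) k'.
Proof.
by move=> H; apply: fmap_Size => n; apply: fmap_Size => m; apply: fmap_ModsAux.
Qed.

Lemma nth_pm (sq : seq pF) i : nth [::] (map pm sq) i = pm (nth [::] sq i).
Proof. by elim: sq i => [|p sq IH] [|i] /=. Qed.

Lemma tmap_PolyComb (sq : seq pF) sc :
  pm (qe_rcf.PolyComb sq sc) = qe_rcf.PolyComb (map pm sq) sc.
Proof.
rewrite /qe_rcf.PolyComb size_map; elim: iota => //= i s IH.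
by rewrite tmap_MulPoly tmap_ExpPoly IH nth_pm.
Qed.

Lemma tmap_Pcq (sq : seq pF) i :
  pm (qe_rcf.Pcq sq i) = qe_rcf.Pcq (map pm sq) i.
Proof.
rewrite /qe_rcf.Pcq -nth_pm -map_comp size_map.
by congr nth; apply: eq_map => sc /=; rewrite tmap_PolyComb.
Qed.

Lemma fmap_TaqR p q k k' : (forall n, fm (k n) = k' n) ->
  fm (qe_rcf.TaqR p q k) = qe_rcf.TaqR (pm p) (pm q) k'.
Proof.
move=> H; rewrite /qe_rcf.TaqR /qe_rcf.bind_def -tmap_Deriv -tmap_MulPoly.
by apply: fmap_Mods => s; apply: fmap_ChangesPoly.
Qed.

Lemma fmap_TaqsR p sq i k k' : (forall t, fm (k t) = k' (tm t)) ->
  fm (qe_rcf.TaqsR p sq i k) = qe_rcf.TaqsR (pm p) (map pm sq) i k'.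
Proof.
move=> H; rewrite /qe_rcf.TaqsR /qe_rcf.bind_def -tmap_Pcq.
by apply: fmap_TaqR => n; rewrite H /= rmorph_int.
Qed.

Lemma tmap_BoundingPoly (sq : seq pF) :
  pm (qe_rcf.BoundingPoly sq) = qe_rcf.BoundingPoly (map pm sq).
Proof.
rewrite /qe_rcf.BoundingPoly tmap_Deriv; congr qe_rcf.Deriv.
by elim: sq => //= p sq IH; rewrite tmap_MulPoly IH.
Qed.

Lemma rmorph_coefs n i : phi (qe_rcf_th.coefs F n i) = qe_rcf_th.coefs G n i.
Proof.
rewrite /qe_rcf_th.coefs.
have E : map_mx phi (map_mx (intmul 1) (qe_rcf_th.ctmat n)) =
    map_mx (intmul 1) (qe_rcf_th.ctmat n).
  by apply/matrixP => a b; rewrite !mxE rmorph_int.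
have M c : map_mx phi (castmx (erefl, c) (invmx (map_mx (intmul 1) (qe_rcf_th.ctmat n)))) =
    castmx (erefl (3 ^ n)%N, c : _ = (3 ^ n).-1.+1)
      (invmx (map_mx (intmul 1) (qe_rcf_th.ctmat n))).
  by rewrite map_castmx map_invmx E.
have [lt_in|ge_in] := ltnP i (size (Finite.enum 'I_(3 ^ n))); last first.
  by rewrite nth_default ?size_map // nth_default ?size_map // rmorph0.
have i0 : 'I_(3 ^ n).
  by move: lt_in; rewrite -enumT size_enum_ord => lt_i; exact: Ordinal lt_i.
by rewrite !(nth_map i0) ?enumT // -M mxE.
Qed.

Lemma tmap_Coefs n i : tm (qe_rcf.Coefs F n i) = qe_rcf.Coefs G n i.
Proof.
rewrite /qe_rcf.Coefs /=; congr qe_rcf.Const; case: n => [|[|n]].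
- by rewrite rmorph_nat.
- by case: i => [|[|[|i]]]; rewrite /= ?(rmorph0, nth_nil) // fmorphV rmorph_nat.
- exact: rmorph_coefs.
Qed.

Lemma fmap_CcountWeak p (sq : seq pF) k k' : (forall t, fm (k t) = k' (tm t)) ->
  fm (qe_rcf.CcountWeak p sq k) = qe_rcf.CcountWeak (pm p) (map pm sq) k'.
Proof.
move=> H; rewrite /qe_rcf.CcountWeak size_map.
set n := (3 ^ _)%N; have -> : qe_rcf.NatConst G 0 = tm (qe_rcf.NatConst F 0) by [].
elim: n (qe_rcf.NatConst F 0) => [|n IH] t //=.
by apply: fmap_TaqsR => u; rewrite IH /= -tmap_Coefs.
Qed.

Lemma fmap_CcountGt0 (sp sq : seq pF) :
  fm (qe_rcf.CcountGt0 sp sq) = qe_rcf.CcountGt0 (map pm sp) (map pm sq).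
Proof.
apply: fmap_BigRgcd => p; apply: fmap_Isnull => -[] /=; last exact: fmap_CcountWeak.
rewrite /qe_rcf.bind_def -tmap_BoundingPoly.
apply: fmap_CcountWeak => t /=; congr (qe_rcf.Or _ (qe_rcf.Or _ _)).
- elim: sq => //= q sq <-; congr qe_rcf.And.
  exact: fmap_LeadCoef.
- elim: sq => //= q sq <-; congr qe_rcf.And.
  by apply: fmap_Size => n; apply: fmap_LeadCoef.
Qed.

Lemma tmap_abstrX i t : pm (qe_rcf.abstrX i t) = qe_rcf.abstrX i (tm t).
Proof.
elim: t => //=.
- by move=> n; case: ifP.
- by move=> t <- u <-; rewrite tmap_AddPoly.
- by move=> t <-; rewrite tmap_OppPoly.
- by move=> t <- n; rewrite /qe_rcf.NatMulPoly tmap_ScalPoly.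
- by move=> t <- u <-; rewrite tmap_MulPoly.
- by move=> t <- n; rewrite tmap_ExpPoly.
Qed.

End Naturality.

(** * Moving points between real closed fields *)

Notation qterm := (qe_rcf.term rat).

(** Finite families of terms are handled as sequences with membership; the
equality test is classical. *)
HB.instance Definition _ := gen_eqMixin qterm.

(** The point is a sequence of coordinates, and a missing coordinate counts as 0. *)
Definition qeval (K : rcfType) (e : seq K) (t : qterm) : K :=
  qe_rcf.eval e (tmap ratr t).

(** The comparison of points with coordinates in two different real closed fields
that drives the transfer: a term that vanishes, is positive or is negative at one
point does the same at the other. *)
Definition same_signs (K L : rcfType) (e : seq K) (e' : seq L) (ts : seq qterm) :=
  {in ts, forall t, sgz (qeval e t) = sgz (qeval e' t)}.

(** The truth of a quantifier-free formula at a point is determined by the signs of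
these terms there. *)
Fixpoint atoms (f : qe_rcf.formula rat) : seq qterm :=
  match f with
  | qe_rcf.Bool _ => [::]
  | qe_rcf.Equal u v | qe_rcf.Lt u v | qe_rcf.Le u v =>
      [:: qe_rcf.Add u (qe_rcf.Opp v)]
  | qe_rcf.And f g | qe_rcf.Or f g | qe_rcf.Implies f g => atoms f ++ atoms g
  | qe_rcf.Not f => atoms f
  end.

Lemma same_signs_atoms (K L : rcfType) (e : seq K) (e' : seq L) f :
  same_signs e e' (atoms f) ->
  qe_rcf.qf_eval e (fmap ratr f) = qe_rcf.qf_eval e' (fmap ratr f).
Proof.
have binop (g h : qe_rcf.formula rat) : same_signs e e' (atoms g ++ atoms h) ->
    same_signs e e' (atoms g) /\ same_signs e e' (atoms h).
  by move=> H; split=> t tg; apply: H; rewrite mem_cat tg ?orbT.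
elim: f => //=.
- move=> u v /(_ _ (mem_head _ _)) H; rewrite -[LHS]subr_eq0 -[RHS]subr_eq0.
  by rewrite -(sgz_eq0 (_ - _)) [sgz _]H sgz_eq0.
- move=> u v /(_ _ (mem_head _ _)) H; rewrite -[LHS]subr_lt0 -[RHS]subr_lt0.
  by rewrite -(sgz_lt0 (_ - _)) [sgz _]H sgz_lt0.
- move=> u v /(_ _ (mem_head _ _)) H; rewrite -[LHS]subr_le0 -[RHS]subr_le0.
  by rewrite -(sgz_le0 (_ - _)) [sgz _]H sgz_le0.
- by move=> f IHf g IHg /binop[/IHf -> /IHg ->].
- by move=> f IHf g IHg /binop[/IHf -> /IHg ->].
- by move=> f IHf g IHg /binop[/IHf -> /IHg ->].
- by move=> f IHf /IHf ->.
Qed.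

(** All the sign conditions on ts, each written as a list of terms that vanish and a
list of terms that are positive. *)
Fixpoint splits (ts : seq qterm) : seq (seq qterm * seq qterm) :=
  if ts is t :: ts' then
    flatten [seq [:: (t :: ab.1, ab.2); (ab.1, t :: ab.2);
                     (ab.1, qe_rcf.Opp t :: ab.2)] | ab <- splits ts']
  else [:: ([::], [::])].

Definition holds_at (K : rcfType) (e : seq K) (ab : seq qterm * seq qterm) :=
  all (fun t => qeval e t == 0) ab.1 && all (fun t => 0 < qeval e t) ab.2.

Lemma splitsP (K : rcfType) (e : seq K) ts :
  exists2 ab, ab \in splits ts & holds_at e ab.
Proof.
elim: ts => [|t ts [[a b] abs /andP[/= Ha Hb]]] /=; first by exists ([::], [::]).
have [tn|tp|t0] := ltgtP (qeval e t) 0.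
- exists (a, qe_rcf.Opp t :: b).
    by apply/flatten_mapP; exists (a, b); rewrite ?inE ?eqxx ?orbT.
  by rewrite /holds_at /= Ha Hb andbT oppr_gt0.
- exists (a, t :: b).
    by apply/flatten_mapP; exists (a, b); rewrite ?inE ?eqxx ?orbT.
  by rewrite /holds_at /= Ha Hb andbT.
- exists (t :: a, b).
    by apply/flatten_mapP; exists (a, b); rewrite ?inE ?eqxx ?orbT.
  by rewrite /holds_at /= Ha Hb t0 eqxx.
Qed.

Lemma holds_at_same_signs (K L : rcfType) (e : seq K) (e' : seq L) ts ab :
  ab \in splits ts -> holds_at e ab -> holds_at e' ab -> same_signs e e' ts.
Proof.
elim: ts ab => [|t ts IH] ab //= /flatten_mapP[[a b] abs].
rewrite !inE => /or3P[] /eqP-> /andP[/= Ha Hb] /andP[/= Ha' Hb'] u;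
  rewrite inE => /predU1P[->{u}|].
- by case/andP: Ha => /eqP-> _; case/andP: Ha' => /eqP-> _; rewrite !sgz0.
- apply: (IH _ abs); apply/andP; split=> //=; [by case/andP: Ha|by case/andP: Ha'].
- by case/andP: Hb => hb _; case/andP: Hb' => hb' _; rewrite !gtr0_sgz.
- apply: (IH _ abs); apply/andP; split=> //=; [by case/andP: Hb|by case/andP: Hb'].
- case/andP: Hb; case/andP: Hb'; rewrite /qeval /= !oppr_gt0 => hb _ hb' _.
  by rewrite !ltr0_sgz.
- apply: (IH _ abs); apply/andP; split=> //=; [by case/andP: Hb|by case/andP: Hb'].
Qed.

(** A quantifier-free formula saying that coordinate i can be chosen such that the
sign condition ab holds. *)
Definition solvable_fml (i : nat) (ab : seq qterm * seq qterm) :=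
  qe_rcf.CcountGt0 (map (qe_rcf.abstrX i) ab.1) (map (qe_rcf.abstrX i) ab.2).

Lemma solvable_fmlP (K : rcfType) (e : seq K) i ab :
  reflect (exists x, holds_at (set_nth 0 e i x) ab)
    (qe_rcf.qf_eval e (fmap ratr (solvable_fml i ab))).
Proof.
rewrite /solvable_fml fmap_CcountGt0 qe_rcf.eval_CcountGt0 -!map_comp.
have E x : holds_at (set_nth 0 e i x) ab =
    all (fun t => (qe_rcf.eval_poly e (map (tmap ratr) (qe_rcf.abstrX i t))).[x] == 0) ab.1 &&
    all (fun t => 0 < (qe_rcf.eval_poly e (map (tmap ratr) (qe_rcf.abstrX i t))).[x]) ab.2.
  by congr (_ && _); apply: eq_all => t; rewrite tmap_abstrX qe_rcf.abstrXP.
apply: (iffP (qe_rcf_th.ccount_gt0P _ _)) => -[x Hx]; exists x; move: Hx;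
  by rewrite E !big_map -!big_all.
Qed.

(** The back-and-forth step. Whether a given sign condition on ts can be realized by
moving coordinate i is expressed by a quantifier-free formula, and there are
finitely many sign conditions; it suffices to compare the signs of the atoms of
these formulas. One list ts' serves for all pairs of fields and points. *)
Lemma extend_point (ts : seq qterm) (i : nat) : exists ts' : seq qterm,
  forall (K L : rcfType) (e : seq K) (e' : seq L), same_signs e e' ts' ->
  forall x', exists x, same_signs (set_nth 0 e i x) (set_nth 0 e' i x') ts.
Proof.
exists (flatten [seq atoms (solvable_fml i ab) | ab <- splits ts]).
move=> K L e e' ss x'.
have [ab abs Hab] := splitsP (set_nth 0 e' i x') ts.
have /solvable_fmlP[x Hx] : qe_rcf.qf_eval e (fmap ratr (solvable_fml i ab)).
  rewrite (same_signs_atoms (e' := e')); last first.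
    by move=> t tin; apply: ss; apply/flatten_mapP; exists ab.
  by apply/solvable_fmlP; exists x'.
by exists x; apply: holds_at_same_signs Hab.
Qed.

Lemma extend_points (m d : nat) (ts : seq qterm) : exists ts' : seq qterm,
  forall (K L : rcfType) (e : seq K) (e' : seq L),
  size e = m -> size e' = m -> same_signs e e' ts' ->
  forall s', size s' = d ->
    exists2 s, size s = d & same_signs (e ++ s) (e' ++ s') ts.
Proof.
elim: d ts => [|d IH] ts.
  exists ts => K L e e' _ _ ss s' /size0nil ->; exists [::] => //.
  by rewrite !cats0.
have [ts1 H1] := extend_point ts (m + d); have [ts2 H2] := IH ts1.
exists ts2 => K L e e' se se' ss s'; case/lastP: s' => // s' x'.
rewrite size_rcons => -[ss'].
have [s sz_s /H1 /(_ x')[x]] := H2 K L e e' se se' ss s' ss'.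
rewrite -[in set_nth _ _ _ x]sz_s -[in set_nth _ _ _ x']ss' -[in set_nth _ _ _ x]se.
rewrite -[in set_nth _ _ _ x']se' -!size_cat => Hx; exists (rcons s x).
  by rewrite size_rcons sz_s.
move: Hx; rewrite -!cats1 !catA.
have setE (T : zmodType) (u : seq T) (y : T) : set_nth 0 u (size u) y = u ++ [:: y].
  by elim: u => //= a u ->.
by rewrite !setE.
Qed.

(** * Real points of prime cones of polynomials *)

(** Terms make sense in every ring; this is what connects terms, polynomials and
points of real closed fields. *)
Fixpoint teval (S : comNzRingType) (c : rat -> S) (e : nat -> S) (t : qterm) : S :=
  match t with
  | qe_rcf.Var i => e i
  | qe_rcf.Const a => c a
  | qe_rcf.NatConst n => n%:R
  | qe_rcf.Add u v => teval c e u + teval c e v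
  | qe_rcf.Opp u => - teval c e u
  | qe_rcf.NatMul u n => teval c e u *+ n
  | qe_rcf.Mul u v => teval c e u * teval c e v
  | qe_rcf.Exp u n => teval c e u ^+ n
  end.

Lemma rmorph_teval (S S' : comNzRingType) (g : {rmorphism S -> S'}) c e t :
  g (teval c e t) = teval (g \o c) (g \o e) t.
Proof.
elim: t => //=.
- by move=> n; rewrite rmorph_nat.
- by move=> u <- v <-; rewrite rmorphD.
- by move=> u <-; rewrite rmorphN.
- by move=> u <- n; rewrite rmorphMn.
- by move=> u <- v <-; rewrite rmorphM.
- by move=> u <- n; rewrite rmorphXn.
Qed.

Lemma eq_teval (S : comNzRingType) (c c' : rat -> S) e e' t :
  c =1 c' -> e =1 e' -> teval c e t = teval c' e' t.
Proof.
move=> ec ee; elim: t => //=.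
- by move=> u -> v ->.
- by move=> u ->.
- by move=> u -> n.
- by move=> u -> v ->.
- by move=> u -> n.
Qed.

Lemma qeval_teval (K : rcfType) (e : seq K) t :
  qeval e t = teval ratr (fun i => e`_i) t.
Proof.
rewrite /qeval; elim: t => //=.
- by move=> u -> v ->.
- by move=> u ->.
- by move=> u -> n.
- by move=> u -> v ->.
- by move=> u -> n.
Qed.

(** A ring morphism from the rationals to a field of characteristic 0 is unique. *)
Lemma rat_rmorphE (K : numFieldType) (f : {rmorphism rat -> K}) a : f a = ratr a.
Proof. by rewrite -(fmorph_rat f) [in RHS]/ratr divq_num_den. Qed.

Section PolynomialTerms.
Variables (R : comNzRingType) (d : nat) (cs : seq R).
Local Notation A := (mpoly.mpoly d R).

Definition mono_term (k : mpoly.multinom d) : qterm :=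
  foldr (fun (i : 'I_d) t => qe_rcf.Mul (qe_rcf.Exp (qe_rcf.Var rat (size cs + i)) (k i)) t)
    (qe_rcf.NatConst rat 1) (enum 'I_d).

(** The coefficients of f become variables as well, numbered by their positions in
cs, and the variables of f come after them: the terms then have rational
constants only. *)
Definition poly_term (f : A) : qterm :=
  foldr (fun k t => qe_rcf.Add
     (qe_rcf.Mul (qe_rcf.Var rat (index (mpoly.mcoeff k f) cs)) (mono_term k)) t)
    (qe_rcf.NatConst rat 0) (mpoly.msupp f).

Lemma teval_mono_term (S : comNzRingType) (c : rat -> S) e k :
  teval c e (mono_term k) = \prod_(i < d) e (size cs + i)%N ^+ k i.
Proof.
rewrite /mono_term -big_enum /=; elim: (enum _) => [|i s IH] /=.
  by rewrite big_nil.
by rewrite big_cons IH.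
Qed.

Lemma teval_poly_term (S : comNzRingType) (c : rat -> S) e f :
  teval c e (poly_term f) = \sum_(k <- mpoly.msupp f)
    e (index (mpoly.mcoeff k f) cs) * \prod_(i < d) e (size cs + i)%N ^+ k i.
Proof.
rewrite /poly_term; elim: (mpoly.msupp f) => [|k s IH] /=.
  by rewrite big_nil.
by rewrite big_cons IH teval_mono_term.
Qed.
End PolynomialTerms.

Lemma mpoly_rat_enum n : exists en : nat -> mpoly.mpoly n rat,
  forall p, exists i, en i = p.
Proof.
exists (fun i => \sum_(cm <- odflt [::] (unpickle i : option (seq (rat * mpoly.multinom n))))
  cm.1 *: mpoly.mpolyX rat cm.2) => p.
exists (pickle [seq (mpoly.mcoeff m p, m) | m <- mpoly.msupp p]).
by rewrite pickleK /= big_map /= -mpoly.mpolyE.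
Qed.

Lemma sgz_ext (K L : realDomainType) (a : K) (b : L) :
  (0 <= a) = (0 <= b) -> (a <= 0) = (b <= 0) -> sgz a = sgz b.
Proof.
have [a0|a0|->] := ltrgt0P a; have [b0|b0|->] := ltrgt0P b => // _ _.
- by rewrite !gtr0_sgz.
- by rewrite !ltr0_sgz.
- by rewrite !sgz0.
Qed.

Section Transfer.
Variables (R : rcfType) (d : nat).
Local Notation A := (mpoly.mpoly d R).

(** Nonnegative constants are squares, so a prime cone induces on the constants the
order that they have. *)
Lemma prime_coneC (P : set A) (a : R) : prime_cone P ->
  P (mpoly.mpolyC d a) <-> 0 <= a.
Proof.
move=> pP; have [_ mulP sqP] := prime_cone_preordering pP.
have pos b : 0 <= b -> P (mpoly.mpolyC d b).
  by move=> b0; rewrite -(sqr_sqrtr b0) rmorphXn; apply: sqP.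
split=> [Pa|]; last exact: pos.
rewrite leNgt; apply/negP => a0; apply: (prime_coneN1 pP).
have -> : -1 = mpoly.mpolyC d a * mpoly.mpolyC d (- a^-1).
  by rewrite -rmorphM mulrN divff ?lt_eqF // rmorphN rmorph1.
by apply: mulP => //; apply: pos; rewrite oppr_ge0 invr_le0 ltW.
Qed.

(** Finitely many polynomials cannot distinguish a prime cone from the cone of the
polynomials nonnegative at a real point. The coefficients cs of the polynomials
and the variables generate a countable subring, the image under theta of a
polynomial ring over the rationals. There the prime cone comes from a morphism phi
to a real closed field F, that is, from a point y with coordinates in F. The first
part e' of y satisfies the same sign conditions as cs, because P induces the usual
order on the constants; by [extend_points] the remaining part s' of y is matched by
a real point s. *)
Lemma prime_cone_point (P : set A) (fs : seq A) : prime_cone P ->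
  {in fs, forall f, P f} ->
  exists x : 'I_d -> R, {in fs, forall f, 0 <= mpoly.meval x f}.
Proof.
move=> pP Pfs.
pose cs : seq R := flatten [seq [seq mpoly.mcoeff k f | k <- mpoly.msupp f] | f <- fs].
pose n := (size cs + d)%N; pose B := mpoly.mpoly n rat.
pose v (i : 'I_n) : A := match fintype.split i with
  | inl j => mpoly.mpolyC d cs`_j | inr j => mpoly.mpolyX R (mpoly.mnm1 j) end.
pose iota_ : {rmorphism rat -> A} := @mpoly.mpolyC d R \o ratr.
pose theta : {rmorphism B -> A} := mpoly.mmap iota_ v.
have [en enP] := mpoly_rat_enum n.
pose P' : set B := theta @^-1` P.
have pP' : prime_cone P'.
  have [addP mulP sqP] := prime_cone_preordering pP.
  have suppE b : cone_support P' b <-> cone_support P (theta b).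
    by rewrite /cone_support /P' /= rmorphN.
  split.
  - split=> [x y Px Py|x y Px Py|x].
    + by rewrite /P' /preimage/= rmorphD; exact: addP.
    + by rewrite /P' /preimage/= rmorphM; exact: mulP.
    + by rewrite /P' /preimage/= rmorphXn; exact: sqP.
  - by rewrite /P' /preimage/= rmorphN rmorph1; exact: prime_coneN1 pP.
  - by move=> x; rewrite /P' /preimage/= rmorphN; exact: prime_cone_total pP _.
  - by move=> x y; rewrite !suppE rmorphM; exact: prime_coneM pP _ _.
have [F [phi phiP]] := prime_cone_real_closed pP' enP.
pose X (i : nat) : B :=
  if insub i is Some j then mpoly.mpolyX rat (mpoly.mnm1 j) else 0.
pose y := mkseq (fun i => phi (X i)) n.
have phi_rat (a : rat) : phi (mpoly.mpolyC n a) = ratr a.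
  exact: (rat_rmorphE (phi \o @mpoly.mpolyC n rat)).
have yE t : phi (teval (@mpoly.mpolyC n rat) X t) = qeval y t.
  rewrite qeval_teval rmorph_teval; apply: eq_teval => [a|i] /=; first exact: phi_rat.
  have [lt_in|ge_in] := ltnP i n; first by rewrite nth_mkseq.
  by rewrite nth_default ?size_mkseq // /X insubN ?rmorph0 // -leqNgt.
have thetaX i : theta (X i) =
    if (i < size cs)%N then mpoly.mpolyC d cs`_i
    else if insub (i - size cs)%N is Some j then mpoly.mpolyX R (mpoly.mnm1 j) else 0.
  rewrite /X; case: insubP => [j _ <-{i}|]; last first.
    rewrite -leqNgt => ni; rewrite rmorph0 ltnNge (leq_trans (leq_addr _ _) ni) /=.
    by rewrite insubN // -leqNgt leq_subRL // (leq_trans (leq_addr _ _) ni).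
  rewrite /theta /= mpoly.mmapX mpoly.mmap1U /v.
  by case: splitP => k -> //; rewrite addKn valK.
have thetaC a : theta (mpoly.mpolyC n a) = mpoly.mpolyC d (ratr a).
  by rewrite /theta /= mpoly.mmapC.
pose s' := drop (size cs) y; pose e' := take (size cs) y.
have sz' : size s' = d by rewrite size_drop size_mkseq addKn.
have sze' : size e' = size cs by rewrite size_takel // size_mkseq leq_addr.
have [ts' Hts'] := extend_points (size cs) d [seq poly_term cs f | f <- fs].
have base : same_signs cs e' ts'.
  move=> t _.
  have ge0 u : (0 <= qeval cs u) = (0 <= qeval e' u).
    (* variables beyond the coefficients are read as 0 by both sequences, so u only
       sees constants of A *)
    pose X' i := if (i < size cs)%N then X i else 0.
    have e1 : qeval e' u = phi (teval (@mpoly.mpolyC n rat) X' u).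
      rewrite qeval_teval rmorph_teval; apply: eq_teval => [a|i] /=.
        by rewrite phi_rat.
      rewrite /X'; case: ltnP => i_cs; last by rewrite nth_default ?sze' ?rmorph0.
      by rewrite nth_take // nth_mkseq // (leq_trans i_cs) // leq_addr.
    have e2 : theta (teval (@mpoly.mpolyC n rat) X' u) = mpoly.mpolyC d (qeval cs u).
      rewrite qeval_teval !rmorph_teval; apply: eq_teval => [a|i] /=; first exact: thetaC.
      rewrite /X'; case: ltnP => i_cs; first by rewrite thetaX i_cs.
      by rewrite nth_default // !rmorph0.
    apply/idP/idP => [/(prime_coneC _ pP)|].
      by rewrite -e2 -[P _]/(P' _) phiP -e1.
    by rewrite e1 -phiP /P' /= e2 => /(prime_coneC _ pP).
  have := ge0 (qe_rcf.Opp t); rewrite {1 2}/qeval /= -!/(qeval _ _) !oppr_ge0 => h.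
  exact: sgz_ext.
have [s sz_s ss] := Hts' R F cs e' erefl sze' base s' sz'.
exists (fun i => s`_i) => f fin.
have coef_in k : k \in mpoly.msupp f -> mpoly.mcoeff k f \in cs.
  move=> kf; apply/flatten_mapP; exists f => //.
  exact: map_f.
have e1 : qeval (cs ++ s) (poly_term cs f) = mpoly.meval (fun i => s`_i) f.
  rewrite qeval_teval teval_poly_term mpoly.mevalE; apply: eq_big_seq => k kf.
  rewrite nth_cat index_mem coef_in // nth_index ?coef_in //; congr (_ * _).
  by apply: eq_bigr => i _; rewrite nth_cat ltnNge leq_addr /= addKn.
have e2 : theta (teval (@mpoly.mpolyC n rat) X (poly_term cs f)) = f.
  rewrite rmorph_teval teval_poly_term [RHS]mpoly.mpolyE; apply: eq_big_seq => k kf /=.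
  rewrite thetaX index_mem coef_in // nth_index ?coef_in // mpoly.mul_mpolyC.
  rewrite mpoly.mpolyXE_id; congr (_ *: _); apply: eq_bigr => i _.
  by rewrite thetaX ltnNge leq_addr /= addKn valK.
rewrite -e1 -sgz_ge0 (ss _ (map_f _ fin)) sgz_ge0 cat_take_drop -yE -phiP.
by rewrite /P' /= e2; exact: Pfs.
Qed.
End Transfer.

(** * The functional of a total convex cone *)

(** A convex cone M of vectors, total on the subspace D and containing l e - v for
large l, is up to its boundary the half-space where a linear functional with value
1 at e is nonnegative. It serves twice: for modules over a semiring, and for the
positive extension of a functional. *)
Section TotalConeFunctional.
Variables (R : realType) (V : lmodType R) (D M : set V) (e : V).
Hypotheses (De : D e) (DD : forall u v, D u -> D v -> D (u + v))
  (DZ : forall c u, D u -> D (c *: u)).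
Hypotheses (MD : forall u v, M u -> M v -> M (u + v))
  (MZ : forall c u, 0 <= c -> M u -> M (c *: u)) (MNe : ~ M (- e))
  (Mtot : forall v, D v -> M v \/ M (- v))
  (Munit : forall v, D v -> exists l, M (l *: e - v)).

Definition cone_functional (v : V) : R := inf [set l | M (l *: e - v)].

Let DN v : D v -> D (- v). Proof. by rewrite -scaleN1r; exact: DZ. Qed.

Lemma cone_scale_unit l : M (l *: e) -> 0 <= l.
Proof.
move=> Ml; rewrite leNgt; apply/negP => l0; apply: MNe.
have -> : - e = (- l^-1) *: (l *: e).
  by rewrite scalerA mulNr mulVf ?lt_eqF // scaleN1r.
by apply: MZ => //; rewrite oppr_ge0 invr_le0 ltW.
Qed.

Let interval l l' v : M (l *: e - v) -> M (v - l' *: e) -> l' <= l.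
Proof.
move=> /MD h /h; rewrite addrA subrK -scalerBl => /cone_scale_unit.
by rewrite subr_ge0.
Qed.

Let has_inf_upper v : D v -> has_inf [set l | M (l *: e - v)].
Proof.
move=> Dv; split; first by have [l] := Munit Dv; exists l.
have [l Ml] := Munit (DN Dv); exists (- l) => l' /interval; apply.
by rewrite scaleNr opprK addrC -[v]opprK.
Qed.

Lemma cone_functional_le v l : D v -> M (l *: e - v) -> cone_functional v <= l.
Proof. by move=> Dv Ml; apply: ge_inf => //; case: (has_inf_upper Dv). Qed.

Lemma cone_functional_ge v l : D v -> M (v - l *: e) -> l <= cone_functional v.
Proof.
move=> Dv Ml; apply: lb_le_inf; first by case: (has_inf_upper Dv).
by move=> l' /interval; apply.
Qed.

Lemma cone_functional_lt v l : D v -> cone_functional v < l -> M (l *: e - v).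
Proof.
move=> Dv /(inf_lt (has_inf_upper Dv).1)[l' Ml' l'l].
have -> : l *: e - v = (l - l') *: e + (l' *: e - v).
  by rewrite addrA -scalerDl subrK.
apply: MD Ml'; have [Me|//] := Mtot De.
by apply: MZ => //; rewrite subr_ge0 ltW.
Qed.

Lemma cone_functional_gt v l : D v -> l < cone_functional v -> M (v - l *: e).
Proof.
move=> Dv lv; have [|] := Mtot (DD (DZ l De) (DN Dv)).
  by move=> /(cone_functional_le Dv); rewrite leNgt lv.
by rewrite opprB.
Qed.

Lemma cone_functional_pos v : D v -> M v -> 0 <= cone_functional v.
Proof. by move=> Dv Mv; apply: cone_functional_ge; rewrite // scale0r subr0. Qed.

Lemma cone_functional1 : cone_functional e = 1.
Proof.
have M0 : M 0.
  by have [|] := Mtot De => /(MZ (lexx 0)); rewrite scale0r.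
apply/eqP; rewrite eq_le cone_functional_le ?cone_functional_ge //.
  by rewrite scale1r subrr.
by rewrite scale1r subrr.
Qed.

Lemma cone_functionalD u v : D u -> D v ->
  cone_functional (u + v) = cone_functional u + cone_functional v.
Proof.
move=> Du Dv; apply/eqP; rewrite eq_le; apply/andP; split;
  apply/ler_addgt0Pr => eps eps0; have h2 : 0 < eps / 2 by rewrite divr_gt0.
  apply: cone_functional_le; first exact: DD.
  have -> : (cone_functional u + cone_functional v + eps) *: e - (u + v) =
      ((cone_functional u + eps / 2) *: e - u) + ((cone_functional v + eps / 2) *: e - v).
    rewrite addrACA -scalerDl opprD; congr (_ *: _ + _); by field.
  by apply: MD; apply: cone_functional_lt; rewrite // ltrDl.
rewrite -lerBlDr; apply: cone_functional_ge; first exact: DD.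
have -> : u + v - (cone_functional u + cone_functional v - eps) *: e =
    (u - (cone_functional u - eps / 2) *: e) + (v - (cone_functional v - eps / 2) *: e).
  rewrite [RHS]addrACA -[in RHS]opprD -scalerDl; congr (_ - _ *: _); by field.
by apply: MD; apply: cone_functional_gt; rewrite // gtrBl.
Qed.

Lemma cone_functional0 : cone_functional 0 = 0.
Proof.
have D0 : D 0 by have := DZ 0 De; rewrite scale0r.
by have /eqP := cone_functionalD D0 D0; rewrite addr0 -subr_eq0 opprD addNKr oppr_eq0 => /eqP.
Qed.

Lemma cone_functionalN v : D v -> cone_functional (- v) = - cone_functional v.
Proof.
move=> Dv; apply/eqP; rewrite -addr_eq0 -cone_functionalD //; last exact: DN.
by rewrite addNr cone_functional0.
Qed.

Lemma cone_functionalZ c v : D v -> cone_functional (c *: v) = c * cone_functional v.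
Proof.
have half c' u : 0 < c' -> D u -> cone_functional (c' *: u) <= c' * cone_functional u.
  move=> c0 Du; rewrite -ler_pdivrMl //; apply/ler_addgt0Pr => eps eps0.
  set l := _ + eps; have lu : cone_functional u < l by rewrite ltrDl.
  rewrite ler_pdivrMl //; apply: cone_functional_le; first exact: DZ.
  rewrite -scalerA -scalerBr; apply: MZ; first exact: ltW.
  exact: cone_functional_lt.
have pos c' u : 0 < c' -> D u -> cone_functional (c' *: u) = c' * cone_functional u.
  move=> c0 Du; apply/eqP; rewrite eq_le half //=.
  have ci : 0 < c'^-1 by rewrite invr_gt0.
  have := half c'^-1 _ ci (DZ c' Du).
  by rewrite scalerA mulVf ?gt_eqF // scale1r ler_pdivlMl.
move=> Dv; have [c0|c0|->] := ltgtP c 0.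
- rewrite -[c in LHS]opprK scaleNr cone_functionalN; last exact: DZ.
  by rewrite pos ?oppr_gt0 // mulNr opprK.
- exact: pos.
- by rewrite scale0r mul0r cone_functional0.
Qed.

End TotalConeFunctional.

(** * Archimedean semirings *)

Section Semirings.
Variables (R : realType) (A : comAlgType R).

Record semiring (S : set A) : Prop := Semiring {
  semiringC : forall c : R, 0 <= c -> S c%:A;
  semiringD : forall x y, S x -> S y -> S (x + y);
  semiringM : forall x y, S x -> S y -> S (x * y) }.

(** Bounded above and below: unlike the one-sided condition, this is stable under
products. *)
Definition bounded (S : set A) (a : A) :=
  exists l : R, S (l%:A - a) /\ S (l%:A + a).

Definition character (phi : A -> R) :=
  [/\ forall c, phi c%:A = c, {morph phi : x y / x + y} &
      {morph phi : x y / x * y}].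

Section Theory.
Variables (S : set A) (sS : semiring S).

Lemma semiring0 : S 0.
Proof. by have := semiringC sS (lexx 0); rewrite scale0r. Qed.

Lemma semiring1 : S 1.
Proof. by have := semiringC sS ler01; rewrite scale1r. Qed.

Lemma semiringZ c x : 0 <= c -> S x -> S (c *: x).
Proof. by move=> c0 Sx; rewrite -mulr_algl; apply: (semiringM sS) => //; apply: (semiringC sS). Qed.

Lemma semiring_sum (I : Type) (r : seq I) (p : pred I) (F : I -> A) :
  (forall i, S (F i)) -> S (\sum_(i <- r | p i) F i).
Proof.
by move=> SF; apply: big_ind => //; [exact: semiring0|exact: (semiringD sS)].
Qed.

Lemma bounded_weaken a l : S (l%:A - a) -> exists m, 0 < m /\ S (m%:A - a).
Proof.
move=> Sl; exists (`|l| + 1); split; first by rewrite ltr_wpDl.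
have -> : (`|l| + 1)%:A - a = (`|l| + 1 - l)%:A + (l%:A - a).
  by rewrite addrA -scalerDl subrK.
apply: (semiringD sS) => //; apply: (semiringC sS) => //.
by have := ler_norm l; lra.
Qed.

Lemma boundedC c : bounded S c%:A.
Proof.
by exists `|c|; split; rewrite -?scalerBl -?scalerDl; apply: (semiringC sS) => //;
  have := ler_norm c; have := ler_norm (- c); rewrite normrN; lra.
Qed.

Lemma boundedD a b : bounded S a -> bounded S b -> bounded S (a + b).
Proof.
move=> [l [l1 l2]] [m [m1 m2]]; exists (l + m); split.
  by rewrite scalerDl opprD addrACA; apply: (semiringD sS).
by rewrite scalerDl addrACA; apply: (semiringD sS).
Qed.

(** 2 (l m - a b) = (l - a)(m + b) + (l + a)(m - b), and likewise for l m + a b. *)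
Lemma boundedM a b : bounded S a -> bounded S b -> bounded S (a * b).
Proof.
move=> [l [l1 l2]] [m [m1 m2]]; exists (l * m).
have lm : (l * m)%:A = l%:A * m%:A :> A by rewrite -scalerAl mul1r scalerA.
split.
  have -> : (l * m)%:A - a * b = 2^-1 *:
      ((l%:A - a) * (m%:A + b) + (l%:A + a) * (m%:A - b)).
    have -> : (l%:A - a) * (m%:A + b) + (l%:A + a) * (m%:A - b) =
        (l%:A * m%:A - a * b) *+ 2 by ring.
    by rewrite -lm -[(_ - _) *+ 2]scaler_nat scalerA mulVf ?scale1r // pnatr_eq0.
  by apply: semiringZ; [rewrite invr_ge0|apply: (semiringD sS); apply: (semiringM sS)].
have -> : (l * m)%:A + a * b = 2^-1 *:
    ((l%:A - a) * (m%:A - b) + (l%:A + a) * (m%:A + b)).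
  have -> : (l%:A - a) * (m%:A - b) + (l%:A + a) * (m%:A + b) =
      (l%:A * m%:A + a * b) *+ 2 by ring.
  by rewrite -lm -[(_ + _) *+ 2]scaler_nat scalerA mulVf ?scale1r // pnatr_eq0.
by apply: semiringZ; [rewrite invr_ge0|apply: (semiringD sS); apply: (semiringM sS)].
Qed.

End Theory.

Section Characters.
Variables (S : set A) (sS : semiring S).
Hypothesis archS : forall a, exists l : R, S (l%:A - a).

Definition module (M : set A) :=
  [/\ forall x y, M x -> M y -> M (x + y), forall s x, S s -> M x -> M (s * x) &
      ~ M (-1)].

(** If neither a nor -a lies in M, then -1 = m + s a and -1 = m' - s' a with s, s' in
S. Eliminating a puts -s in M. As l + a lies in S for some l > 0, the element
s a = s (l + a) - l s lies in M, and hence so does -1 = m + s a. *)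
Lemma max_module_total (M : set A) : module M -> S `<=` M ->
  (forall B, M `<=` B -> module B -> B `<=` M) -> forall a, M a \/ M (- a).
Proof.
move=> [MD MM MN1] SM Mmax a.
have adjoin b : ~ M b -> exists m s, [/\ M m, S s & -1 = m + s * b].
  move=> Mb; apply: contrapT => none; apply: Mb.
  have sub : M `<=` [set x | exists m s, [/\ M m, S s & x = m + s * b]].
    move=> m Mm; exists m, 0; rewrite mul0r addr0; split=> //.
    exact: (semiring0 sS).
  apply: (Mmax _ sub); last first.
    exists 0, 1; rewrite mul1r add0r; split=> //; last exact: (semiring1 sS).
    by apply: SM; exact: (semiring0 sS).
  split=> //.
  - move=> _ _ [m [s [Mm Ss ->]]] [m' [s' [Mm' Ss' ->]]].
    by exists (m + m'), (s + s'); split; [exact: MD|exact: (semiringD sS)|ring].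
  - move=> t _ St [m [s [Mm Ss ->]]].
    by exists (t * m), (t * s); split; [exact: MM|exact: (semiringM sS)|ring].
have [|Ma] := pselect (M a); first by left.
right; apply: contrapT => Mna; apply: MN1.
have [m [s [Mm Ss e]]] := adjoin _ Ma.
have [m' [s' [Mm' Ss' e']]] := adjoin _ Mna.
(* -s lies in M, because -(s + s') = s' m + s m' does *)
have MNs : M (- s).
  have -> : - s = s' * m + s * m' + s'.
    have -> : m = -1 - s * a by rewrite e addrK.
    have -> : m' = -1 - s' * - a by rewrite e' addrK.
    ring.
  by apply: (MD); [apply: (MD); apply: (MM)|exact: SM].
have [l0 Sl0] := archS (- a).
have [l [l_gt0 Sl]] := bounded_weaken sS Sl0.
rewrite e; apply: (MD) => //.
have -> : s * a = s * (l%:A - - a) + l%:A * - s by ring.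
apply: (MD); first by apply: SM; apply: (semiringM sS).
by apply: (MM) => //; apply: (semiringC sS) => //; apply: ltW.
Qed.

(** The functional phi of a maximal module is multiplicative. If phi a = 0, then a + eps
and eps - a lie in M for every eps > 0; multiplying by b in S stays in M, so
|phi (a b)| <= eps phi b, and phi (a b) = 0. The general case follows on replacing
a by a - phi a and shifting b into S by a constant. *)
Lemma module_character (M0 : set A) : module M0 -> S `<=` M0 ->
  exists phi, character phi /\ forall a, M0 a -> 0 <= phi a.
Proof.
move=> mM0 SM0.
have [//|F [X0 FX0] FP FT Ftot|M [M0M mM Mmax]] := @Zorn_above A module M0.
  split=> [x y Fx Fy|s x Ss [X FX Xx]|[X FX Xx]].
  - have [Z [FZ Zx Zy]] := chain_pair Ftot Fx Fy; exists Z => //.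
    by have [addZ _ _] := FP _ FZ; apply: addZ.
  - by exists X => //; have [_ mulX _] := FP _ FX; apply: mulX.
  - by have [_ _] := FP _ FX; apply.
have SM : S `<=` M := subset_trans SM0 M0M.
have Mtot := max_module_total mM SM Mmax.
have [MD MM MN1] := mM.
have MZ c u : 0 <= c -> M u -> M (c *: u).
  by move=> c0 Mu; rewrite -mulr_algl; apply: (MM) => //; apply: (semiringC sS).
have Munit v : setT v -> exists l : R, M (l%:A - v).
  by move=> _; have [l /SM] := archS v; exists l.
pose phi := cone_functional M (1 : A).
have phiD u v : phi (u + v) = phi u + phi v.
  exact: (@cone_functionalD R A setT M 1).
have phiZ c v : phi (c *: v) = c * phi v.
  exact: (@cone_functionalZ R A setT M 1).
have phi1 : phi 1 = 1 by exact: (@cone_functional1 R A setT M 1).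
have phi_pos v : M v -> 0 <= phi v.
  exact: (@cone_functional_pos R A setT M 1).
have phiC c : phi c%:A = c by rewrite phiZ phi1 mulr1.
have phiN v : phi (- v) = - phi v by rewrite -scaleN1r phiZ mulN1r.
have null a b : phi a = 0 -> S b -> phi (a * b) = 0.
  move=> a0 Sb; have b0 : 0 <= phi b := phi_pos _ (SM _ Sb).
  have small eps : 0 < eps -> `|phi (a * b)| <= eps * phi b.
    move=> eps0; rewrite ler_norml; apply/andP; split.
      rewrite -subr_ge0 opprK -phiZ -phiD -mulr_algl -mulrDl; apply: phi_pos.
      rewrite mulrC; apply: (MM) => //; rewrite addrC -[a]opprK.
      apply: (@cone_functional_lt R A setT M 1) => //.
      by rewrite -/phi phiN a0 oppr0.
    rewrite -subr_ge0 -phiZ -phiN -phiD -mulr_algl -mulrBl; apply: phi_pos.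
    rewrite mulrC; apply: (MM) => //.
    by apply: (@cone_functional_lt R A setT M 1) => //; rewrite -/phi a0.
  apply/eqP; rewrite -normr_le0; apply/ler_addgt0Pr => eps eps0; rewrite add0r.
  have d0 : 0 < phi b + 1 by rewrite ltr_wpDl.
  apply: le_trans (small (eps / (phi b + 1)) (divr_gt0 eps0 d0)) _.
  rewrite mulrAC ler_pdivrMr // ler_wpM2l ?ltW //; lra.
exists phi; split=> [|a /M0M]; last exact: phi_pos.
split=> // a b.
pose a' := a - (phi a)%:A.
have a'0 : phi a' = 0 by rewrite phiD phiN phiC subrr.
have [l0 Sl0] := archS (- b).
rewrite opprK in Sl0.
have : phi (a' * (l0%:A + b)) = 0 by exact: null.
rewrite mulrDr phiD mulr_algr phiZ a'0 mulr0 add0r mulrBl mulr_algl phiD phiN phiZ.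
by move/eqP; rewrite subr_eq0 => /eqP.
Qed.

(** If no s in S satisfied s h - 1 in S, then S - S h would be a proper module, and
the morphism that it yields would be nonpositive at h. Given such an s and n - s in
S, the identity n (h + k) - 1 = (n - s)(h + k) + (s h - 1) + k s shows that k can be
lowered by 1/n as long as h + k lies in S and k >= 0. *)
Lemma archimedean_positivstellensatz (h : A) :
  (forall phi, character phi -> (forall a, S a -> 0 <= phi a) -> 0 < phi h) ->
  S h.
Proof.
move=> hpos.
have [s Ss Ssh] : exists2 s, S s & S (s * h - 1).
  apply: contrapT => none.
  pose M : set A := [set x | exists s t, [/\ S s, S t & x = t - s * h]].
  have SM : S `<=` M.
    by move=> t St; exists 0, t; rewrite mul0r subr0; split=> //; exact: (semiring0 sS).
  have mM : module M.
    split.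
    - move=> _ _ [s [t [Ss St ->]]] [s' [t' [Ss' St' ->]]].
      by exists (s + s'), (t + t'); split; [exact: (semiringD sS)|exact: (semiringD sS)|ring].
    - move=> r _ Sr [s [t [Ss St ->]]].
      by exists (r * s), (r * t); split; [exact: (semiringM sS)|exact: (semiringM sS)|ring].
    - move=> [s [t [Ss St e]]]; apply: none; exists s => //.
      have -> : s * h - 1 = t by rewrite addrC e subrK.
      by [].
  have [phi [cphi phi_pos]] := module_character mM SM.
  have := hpos phi cphi (fun a Sa => phi_pos a (SM a Sa)).
  have [phiC phiD phiM] := cphi.
  have : 0 <= phi (- h).
    apply: phi_pos; exists 1, 0; rewrite mul1r sub0r; split=> //.
      exact: (semiring1 sS).
    exact: (semiring0 sS).
  have -> : phi (- h) = - phi h.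
    by apply/eqP; rewrite -addr_eq0 -phiD addNr -(scale0r 1) phiC.
  by rewrite oppr_ge0 leNgt => /negP.
have [n0 Sn0] := archS s.
have [n [n_gt0 Sn]] := bounded_weaken sS Sn0.
have step (k : R) : 0 <= k -> S (h + k%:A) -> S (h + (k - n^-1)%:A).
  move=> k0 Shk.
  have -> : h + (k - n^-1)%:A = n^-1 *:
      ((n%:A - s) * (h + k%:A) + (s * h - 1) + k%:A * s).
    have -> : (n%:A - s) * (h + k%:A) + (s * h - 1) + k%:A * s =
      n%:A * (h + k%:A) - 1 by ring.
    rewrite mulr_algl scalerBr scalerA mulVf ?gt_eqF // scale1r scalerBl.
    by rewrite addrA.
  apply: (semiringZ sS) => //; first by rewrite invr_ge0 ltW.
  apply: (semiringD sS) => //; last by apply: (semiringM sS) => //; apply: (semiringC sS).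
  by apply: (semiringD sS) => //; apply: (semiringM sS).
have [k0 Sk0] := archS (- h).
have [k [k_gt0 Sk]] := bounded_weaken sS Sk0.
rewrite opprK addrC in Sk.
have iter_step (i : nat) : exists c : R, c <= k - n^-1 *+ i /\ S (h + c%:A) \/ S h.
  elim: i => [|i [c [[ck Sc]|Sh]]]; [by exists k; left; rewrite subr0| |by exists 0; right].
  have [c0|c0] := leP 0 c.
    exists (c - n^-1); left; split; last exact: step.
    by rewrite mulrS; lra.
  exists 0; right; have -> : h = (h + c%:A) + (- c)%:A.
    by rewrite scaleNr addrK.
  by apply: (semiringD sS) => //; apply: (semiringC sS); rewrite // oppr_ge0 ltW.
have [c [[ck Sc]|//]] := iter_step (Num.truncn (k * n)).+1.
have -> : h = (h + c%:A) + (- c)%:A by rewrite scaleNr addrK.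
apply: (semiringD sS) => //; apply: (semiringC sS); rewrite // oppr_ge0.
apply: le_trans ck _; rewrite subr_le0 -mulr_natr mulrC ler_pdivlMr //.
exact/ltW/truncnS_gt.
Qed.

End Characters.
End Semirings.

(** * Preorderings of polynomials and the infeasibility certificate *)

Section PolynomialRing.
Variables (R : realType) (d : nat).
Local Notation A := (polyring R d).
Local Notation "''x_' i" := (mpoly.mpolyX R (mpoly.mnm1 i)) (at level 8, i at level 2).

Lemma pevalC (c : R) x : peval (c%:A : A) x = c.
Proof. by rewrite /peval mpoly.alg_mpolyC mpoly.mevalC. Qed.
Lemma pevalD (p q : A) x : peval (p + q) x = peval p x + peval q x.
Proof. exact: rmorphD. Qed.
Lemma pevalM (p q : A) x : peval (p * q) x = peval p x * peval q x.
Proof. exact: rmorphM. Qed.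
Lemma pevalB (p q : A) x : peval (p - q) x = peval p x - peval q x.
Proof. exact: rmorphB. Qed.
Lemma pevalN (p : A) x : peval (- p) x = - peval p x.
Proof. exact: rmorphN. Qed.
Lemma pevalZ c (p : A) x : peval (c *: p) x = c * peval p x.
Proof. by rewrite -mulr_algl pevalM pevalC. Qed.
Lemma pevalX i x : peval ('x_i : A) x = x ord0 i.
Proof. exact: mpoly.mevalXU. Qed.

(** Constants and variables generate the algebra of polynomials. *)
Lemma polyring_ind (Q : A -> Prop) :
  (forall c : R, Q c%:A) -> (forall i, Q 'x_i) ->
  (forall p q, Q p -> Q q -> Q (p + q)) ->
  (forall p q, Q p -> Q q -> Q (p * q)) -> forall p, Q p.
Proof.
move=> QC QX QD QM; elim/mpoly.mpolyind => [|c m p _ _ Qp].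
  by rewrite -(scale0r 1); exact: QC.
apply: (QD) Qp; rewrite -mulr_algl; apply: (QM); first exact: QC.
rewrite mpoly.mpolyXE_id; apply: big_ind => //.
  by rewrite -(scale1r 1); exact: QC.
move=> i _; elim: (m i) => [|n IH]; first by rewrite expr0 -(scale1r 1); exact: QC.
by rewrite exprS; apply: (QM).
Qed.

(** The coordinates of the point are the values at the variables. *)
Lemma character_peval (phi : A -> R) : character phi ->
  exists x, forall p, phi p = peval p x.
Proof.
move=> [phiC phiD phiM]; exists (\row_i phi 'x_i); apply: polyring_ind.
- by move=> c; rewrite pevalC phiC.
- by move=> i; rewrite pevalX mxE.
- by move=> p q ep eq; rewrite phiD ep eq pevalD.
- by move=> p q ep eq; rewrite phiM ep eq pevalM.
Qed.

Section Bounded.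
Variables (S : set A) (sS : semiring S).

Lemma bounded_variables : (forall i, bounded S 'x_i) -> forall p, bounded S p.
Proof.
move=> SX; apply: polyring_ind => //.
- exact: boundedC.
- exact: boundedD.
- exact: boundedM.
Qed.

(** c - x_i^2 lies in S, and 2 ((c + 1)/2 + a) = (c - a^2) + (a + 1)^2 for a = x_i
and for a = - x_i. *)
Lemma ball_bounded (c : R) : 0 <= c -> (forall p, S (p ^+ 2)) ->
  S (c%:A - \sum_i 'x_i ^+ 2) -> forall p, bounded S p.
Proof.
move=> c0 sqS Sc; apply: bounded_variables => i.
have Si : S (c%:A - 'x_i ^+ 2).
  rewrite (_ : _ - _ = (c%:A - \sum_j 'x_j ^+ 2) + \sum_(j | j != i) 'x_j ^+ 2).
    by apply: (semiringD sS) => //; apply: semiring_sum.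
  by rewrite [in RHS](bigD1 i) //= opprD addrA subrK.
have half (a : A) : S (c%:A - 'x_i ^+ 2 + (a + 1) ^+ 2) -> a ^+ 2 = 'x_i ^+ 2 ->
    S (((c + 1) / 2)%:A + a).
  move=> Sa a2; rewrite (_ : _ + a = 2^-1 *: (c%:A - 'x_i ^+ 2 + (a + 1) ^+ 2)).
    by apply: (semiringZ sS); rewrite ?invr_ge0.
  have -> : c%:A - 'x_i ^+ 2 + (a + 1) ^+ 2 = (c + 1)%:A + 2 *: a.
    by rewrite -a2 scalerDl scale1r scaler_nat; ring.
  by rewrite scalerDr !scalerA mulVf ?pnatr_eq0 // scale1r mulrC.
exists ((c + 1) / 2); split; apply: half; rewrite ?sqrrN //;
  by apply: (semiringD sS).
Qed.
End Bounded.

Inductive preord_gen (I : Type) (f : I -> A) : A -> Prop :=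
| PreordGen i : preord_gen f (f i)
| PreordSqr p : preord_gen f (p ^+ 2)
| PreordD p q of preord_gen f p & preord_gen f q : preord_gen f (p + q)
| PreordM p q of preord_gen f p & preord_gen f q : preord_gen f (p * q).

Lemma preord_genC (I : Type) (f : I -> A) c : 0 <= c -> preord_gen f c%:A.
Proof.
move=> c0; rewrite (_ : c%:A = (Num.sqrt c)%:A ^+ 2); first exact: PreordSqr.
by rewrite -{1}(sqr_sqrtr c0) !expr2 -scalerAl mul1r scalerA.
Qed.

Lemma preord_gen_semiring (I : Type) (f : I -> A) : semiring (preord_gen f).
Proof.
by split=> [c|p q|p q]; [exact: preord_genC|exact: PreordD|exact: PreordM].
Qed.

(** Only finitely many squares enter an element of a preordering, so the element
lies in every semiring that contains f and those squares. *)
Lemma preord_gen_finite (I : Type) (f : I -> A) a : preord_gen f a ->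
  exists ps : seq A, forall S, semiring S -> (forall i, S (f i)) ->
    {in ps, forall p, S (p ^+ 2)} -> S a.
Proof.
elim=> [i|p|p q _ [ps Hp] _ [qs Hq]|p q _ [ps Hp] _ [qs Hq]].
- by exists [::].
- by exists [:: p] => S _ _; apply; rewrite inE.
- exists (ps ++ qs) => S sS Sf Sps; apply: (semiringD sS).
    by apply: Hp => // p' p'p; apply: Sps; rewrite mem_cat p'p.
  by apply: Hq => // p' p'p; apply: Sps; rewrite mem_cat p'p orbT.
- exists (ps ++ qs) => S sS Sf Sps; apply: (semiringM sS).
    by apply: Hp => // p' p'p; apply: Sps; rewrite mem_cat p'p.
  by apply: Hq => // p' p'p; apply: Sps; rewrite mem_cat p'p orbT.
Qed.

(** The elements s - g t form a preordering T. If -1 were not in it, a prime cone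
containing f and -g would exist, and [prime_cone_point] would give a real point
with f >= 0 and g <= 0. *)
Lemma exists_negative_certificate (I : finType) (f : I -> A) (g : A) :
  (forall x, (forall i, 0 <= peval (f i) x) -> 0 < peval g x) ->
  exists s t, [/\ preord_gen f s, preord_gen f t & g * t = 1 + s].
Proof.
move=> gpos; pose T := [set a | exists s t, [/\ preord_gen f s, preord_gen f t & a = s - g * t]].
have T0 := semiring0 (preord_gen_semiring f).
have pT : preordering T.
  split=> [_ _ [s [t [Hs Ht ->]]] [s' [t' [Hs' Ht' ->]]]
          |_ _ [s [t [Hs Ht ->]]] [s' [t' [Hs' Ht' ->]]]|a].
  - by exists (s + s'), (t + t'); split; [exact: PreordD|exact: PreordD|ring].
  - exists (s * s' + g ^+ 2 * (t * t')), (s * t' + t * s'); split; last by ring.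
      apply: PreordD; first exact: PreordM.
      by apply: PreordM; [exact: PreordSqr|exact: PreordM].
    by apply: PreordD; apply: PreordM.
  - by exists (a ^+ 2), 0; rewrite mulr0 subr0; split => //; exact: PreordSqr.
have [[s [t [Hs Ht e]]]|TN1] := pselect (T (-1)).
  by exists s, t; split=> //; rewrite -[1]opprK e; ring.
have [P TP pP] := exists_prime_cone pT TN1.
have [|x Hx] := @prime_cone_point R d P (- g :: [seq f i | i <- enum I]) pP.
  move=> h; rewrite inE => /predU1P[->|/mapP[i _ ->]]; apply: TP.
    exists 0, 1; rewrite mulr1 sub0r; split=> //.
    exact: (semiring1 (preord_gen_semiring f)).
  by exists (f i), 0; rewrite mulr0 subr0; split=> //; exact: PreordGen.
have e p : mpoly.meval x p = peval p (\row_i x i).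
  by apply: mpoly.meval_eq => i; rewrite mxE.
have : 0 < peval g (\row_i x i).
  apply: gpos => i; rewrite -e; apply: Hx.
  by rewrite inE map_f ?orbT // mem_enum.
by rewrite ltNge -oppr_ge0 -pevalN -e Hx // inE eqxx.
Qed.
End PolynomialRing.

(** * Boundedness certificates over a compact set *)

Section Archimedean.
Variables (R : realType) (d : nat).
Local Notation A := (polyring R d).
Local Notation "''x_' i" := (mpoly.mpolyX R (mpoly.mnm1 i)) (at level 8, i at level 2).

(** A certificate of positivity of g = c - |x|^2 bounds everything. In the preordering
generated by g every polynomial is bounded, so k - s = u + g v with u, v sums of
squares; then (1 + s)(k - s) = (1 + s) u + g^2 t v lies in the preordering T of f.
Adding (k/2 - s)^2 gives k + k^2/4 - s in T. Finally, for k' = k + k^2/4,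
c (1 + k') - |x|^2 = g^2 t + s |x|^2 + c (k' - s). *)
Lemma ball_certificate_bounded (I : Type) (f : I -> A) (c : R) (s t : A) :
  0 <= c -> preord_gen f s -> preord_gen f t ->
  (c%:A - \sum_i 'x_i ^+ 2) * t = 1 + s -> forall p, bounded (preord_gen f) p.
Proof.
move=> c0 Ts Tt; set q := \sum_i _; set g := _ - q => e.
have sT := preord_gen_semiring f.
have sqT p : preord_gen f (p ^+ 2) by exact: PreordSqr.
(* O: the preordering generated by nothing, that is, the sums of squares *)
pose O (p : A) := preord_gen (fun v : void => of_void A v) p.
have sO : semiring O by exact: preord_gen_semiring.
have OT p : O p -> preord_gen f p.
  elim=> [[]|a|a b _ Ha _ Hb|a b _ Ha _ Hb] //; [exact: PreordD|exact: PreordM].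
have sqO p : O (p ^+ 2) by exact: PreordSqr.
pose B : set A := [set a | exists u v, [/\ O u, O v & a = u + g * v]].
have O0 := semiring0 sO.
have sB : semiring B.
  split=> [l l0|_ _ [u [v [Hu Hv ->]]] [u' [v' [Hu' Hv' ->]]]
              |_ _ [u [v [Hu Hv ->]]] [u' [v' [Hu' Hv' ->]]]].
  - by exists l%:A, 0; rewrite mulr0 addr0; split=> //; exact: (semiringC sO).
  - by exists (u + u'), (v + v'); split; [exact: (semiringD sO)|exact: (semiringD sO)|ring].
  - exists (u * u' + g ^+ 2 * (v * v')), (u * v' + v * u'); split; last by ring.
      apply: (semiringD sO); first exact: (semiringM sO).
      by apply: (semiringM sO) => //; exact: (semiringM sO).
    by apply: (semiringD sO); exact: (semiringM sO).
have sqB p : B (p ^+ 2) by exists (p ^+ 2), 0; rewrite mulr0 addr0.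
have Bg : B g by exists 0, 1; rewrite mulr1 add0r; split=> //; exact: (semiring1 sO).
have [k0 [Bk0 _]] := ball_bounded sB c0 sqB Bg s.
have [k [k_gt0 [u [v [Ou Ov ks]]]]] := bounded_weaken sB Bk0.
have T1s : preord_gen f (1 + s) by apply: PreordD => //; exact: (semiring1 sT).
have H1 : preord_gen f ((1 + s) * (k%:A - s)).
  rewrite ks (_ : (1 + s) * (u + g * v) = (1 + s) * u + g ^+ 2 * (t * v)).
    by apply: PreordD; apply: PreordM => //; [exact: OT|apply: PreordM => //; exact: OT].
  by rewrite -e; ring.
have H2 : preord_gen f ((k + (k / 2) ^+ 2)%:A - s).
  rewrite (_ : _ - s = (1 + s) * (k%:A - s) + ((k / 2)%:A - s) ^+ 2); first exact: PreordD.
  have kk : k%:A = (k / 2)%:A + (k / 2)%:A :> A by rewrite -scalerDl -splitr.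
  have k2 : ((k / 2) ^+ 2)%:A = (k / 2)%:A ^+ 2 :> A.
    by rewrite [RHS]expr2 -scalerAl mul1r scalerA -expr2.
  by rewrite scalerDl k2 kk; ring.
set k' := k + _ in H2.
have k'0 : 0 <= k' by rewrite addr_ge0 ?sqr_ge0 // ltW.
have H3 : preord_gen f ((c * (1 + k'))%:A - q).
  rewrite (_ : _ - q = g ^+ 2 * t + s * q + c%:A * (k'%:A - s)).
    apply: PreordD; [apply: PreordD; apply: PreordM => //|
                     apply: PreordM => //; exact: preord_genC].
    by apply: (semiring_sum sT) => i; exact: sqT.
  have -> : (c * (1 + k'))%:A = c%:A * (1 + k'%:A) :> A.
    by rewrite mulr_algl scalerDr scalerA -scalerDl mulrDr mulr1.
  rewrite expr2 -mulrA e /g; ring.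
by apply: (ball_bounded sT) H3 => //; rewrite mulr_ge0 // addr_ge0.
Qed.

Lemma le_coord_norm (x : 'rV[R]_d) i : `|x ord0 i| <= `|x|.
Proof.
rewrite [leRHS]/Num.Def.normr/= mx_normrE; apply/bigmax_geP; right => /=.
by exists (ord0, i).
Qed.

(** If the coordinates are bounded by N in absolute value, then |x|^2 < d N^2 + 1. *)
Lemma semialg_ball_bound (r : nat) (f : 'I_r -> A) : compact (semialg f) ->
  exists c, 0 <= c /\
    forall x, semialg f x -> 0 < peval (c%:A - \sum_i 'x_i ^+ 2 : A) x.
Proof.
move=> /compact_bounded[M [Mr HM]].
have M1 : M < `|M| + 1 by rewrite (le_lt_trans (ler_norm M)) // ltrDl.
pose N := `|M| + 1.
exists (N ^+ 2 *+ d + 1); split; first by rewrite addr_ge0 // mulrn_wge0 // sqr_ge0.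
move=> x /(HM _ M1) xN; rewrite pevalB pevalC subr_gt0.
have -> : peval (\sum_i 'x_i ^+ 2 : A) x = \sum_i x ord0 i ^+ 2.
  rewrite /peval rmorph_sum; apply: eq_bigr => i _.
  by rewrite rmorphXn /= mpoly.mevalXU.
rewrite ltr_pwDr //.
rewrite -[leRHS](_ : \sum_(i < d) N ^+ 2 = _); last by rewrite sumr_const card_ord.
apply: ler_sum => i _; rewrite -[leLHS]real_normK ?num_real // ler_sqr ?nnegrE ?addr_ge0 //.
by apply: le_trans xN; exact: le_coord_norm.
Qed.

End Archimedean.

Section SemiringGen.
Variables (R : realType) (d : nat).
Local Notation A := (polyring R d).

Lemma semiring_gen_monomial (I : finType) (q : I -> A) c (k : I -> nat) :
  0 <= c -> semiring_gen q (c *: \prod_i q i ^+ k i).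
Proof.
by move=> c0; exists 1%N, (fun=> c), (fun=> k); split=> //; rewrite big_ord1.
Qed.

Lemma semiring_gen_semiring (I : finType) (q : I -> A) : semiring (semiring_gen q).
Proof.
have add p p' : semiring_gen q p -> semiring_gen q p' -> semiring_gen q (p + p').
  move=> [N [a [n [a0 ->]]]] [N' [a' [n' [a0' ->]]]].
  pose pick T (u : 'I_N -> T) (v : 'I_N' -> T) (t : 'I_(N + N')) :=
    match fintype.split t with inl i => u i | inr j => v j end.
  exists (N + N')%N, (pick _ a a'), (pick _ n n'); split.
    by move=> t; rewrite /pick; case: (fintype.split t).
  rewrite big_split_ord /=; congr (_ + _); apply: eq_bigr => t _; rewrite /pick.
    by rewrite (unsplitK (inl _ t)).
  by rewrite (unsplitK (inr _ t)).
have zero : semiring_gen q 0.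
  by exists 0%N, (fun=> 0), (fun _ _ => 0%N); split=> //; rewrite big_ord0.
have sum N (F : 'I_N -> A) : (forall t, semiring_gen q (F t)) ->
    semiring_gen q (\sum_(t < N) F t).
  by move=> HF; apply: big_ind.
split=> // [c c0|p p' [N [a [n [a0 ->]]]] [N' [a' [n' [a0' ->]]]]].
  have := @semiring_gen_monomial _ q c (fun=> 0%N) c0.
  by rewrite big1.
rewrite big_distrl; apply: (sum) => t; rewrite big_distrr; apply: (sum) => t'.
rewrite /= -scalerAl -scalerAr scalerA -big_split /=.
under eq_bigr do rewrite -exprD.
by apply: semiring_gen_monomial; rewrite mulr_ge0.
Qed.

Lemma semiring_gen_mem (I : finType) (q : I -> A) i : semiring_gen q (q i).
Proof.
have := @semiring_gen_monomial _ q 1 (fun j => (j == i)) ler01.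
rewrite scale1r (bigD1 i) //= eqxx expr1 big1 ?mulr1 // => j /negPf ->.
by rewrite expr0.
Qed.

(** An exponent of f_i is the sum of its parity and of twice its half. *)
Lemma semiring_gen_fp_sum r s (f : 'I_r -> A) (p : 'I_s -> A) h :
  semiring_gen (fp_gens f p) h -> fp_sum f p h.
Proof.
move=> [N [a [n [a0 ->]]]].
exists N, a, (fun t i => odd (n t (inl i))), (fun t i => (n t (inl i))./2),
  (fun t j => n t (inr j)); split=> //.
apply: eq_bigr => t _; rewrite /fp_term big_sumType /= -big_split /=.
congr (_ *: (_ * _)); apply: eq_bigr => i _.
  by rewrite -exprD mul2n odd_double_half.
by rewrite -exprM.
Qed.

Lemma fp_gens_pos r s (f : 'I_r -> A) (p : 'I_s -> A) x :
  (forall q, semiring_gen (fp_gens f p) q -> 0 <= peval q x) -> semialg f x.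
Proof. by move=> H i; apply: H; exact: (@semiring_gen_mem _ (fp_gens f p) (inl i)). Qed.

(** By [bounded_variables] it suffices that the variables be bounded, and the
certificates of this involve finitely many squares. *)
Lemma exists_archimedean_squares r (f : 'I_r -> A) : compact (semialg f) ->
  exists s : nat, (0 < s)%N /\ exists p : 'I_s -> A,
    forall a, bounded (semiring_gen (fp_gens f p)) a.
Proof.
move=> /semialg_ball_bound[c [c0 cpos]].
have [s [t [Hs Ht e]]] := exists_negative_certificate cpos.
have bd := ball_certificate_bounded c0 Hs Ht e.
pose X i : A := mpoly.mpolyX R (mpoly.mnm1 i).
have Xps i : exists ps : seq A, forall S, semiring S -> (forall j, S (f j)) ->
    {in ps, forall p, S (p ^+ 2)} -> bounded S (X i).
  have [l [/preord_gen_finite[ps Hps] /preord_gen_finite[qs Hqs]]] := bd (X i).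
  exists (ps ++ qs) => S sS Sf Sps; exists l; split.
    by apply: Hps => // p pin; apply: Sps; rewrite mem_cat pin.
  by apply: Hqs => // p pin; apply: Sps; rewrite mem_cat pin orbT.
have [ps Hps] := choice Xps.
(* the entry 0 makes the list of squares nonempty *)
pose qs := 0 :: flatten [seq ps i | i <- enum 'I_d].
exists (size qs); split=> //; exists (fun j => qs`_j).
have sS := semiring_gen_semiring (fp_gens f (fun j : 'I_(size qs) => qs`_j)).
apply: (bounded_variables sS) => i; apply: (Hps i) => // [j|p pin].
  exact: (@semiring_gen_mem _ (fp_gens f (fun j : 'I_(size qs) => qs`_j)) (inl j)).
have pqs : p \in qs.
  by rewrite inE; apply/orP; right; apply/flatten_mapP; exists i; rewrite ?mem_enum.
have lt_p : (index p qs < size qs)%N by rewrite index_mem.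
have := @semiring_gen_mem _ (fp_gens f (fun j : 'I_(size qs) => qs`_j)) (inr (Ordinal lt_p)).
by rewrite /= nth_index.
Qed.

(** A real-valued character of the polynomial ring is evaluation at a point, and this
point lies in the set when the character is nonnegative on f. *)
Lemma bounded_positivstellensatz r s (f : 'I_r -> A) (p : 'I_s -> A) :
  (forall a, bounded (semiring_gen (fp_gens f p)) a) ->
  forall h : A, (forall x, semialg f x -> 0 < peval h x) ->
  semiring_gen (fp_gens f p) h.
Proof.
move=> bd h hpos.
apply: (archimedean_positivstellensatz (semiring_gen_semiring _)) => [a|phi].
  by have [l [Sl _]] := bd a; exists l.
move=> /character_peval[x ex] pos; rewrite ex; apply: hpos.
by apply: (@fp_gens_pos _ _ f p) => q /pos; rewrite ex.
Qed.

End SemiringGen.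

(** * Positive extension of a functional to all bounded functions *)

Section PositiveExtension.
Variables (R : realType) (d : nat) (K : set 'rV[R]_d).
Local Notation A := (polyring R d).
Local Notation V := ('rV[R]_d -> R^o).

Definition bounded_on (g : V) := exists b : R, forall x, K x -> `|g x| <= b.

Lemma bounded_onD f g : bounded_on f -> bounded_on g -> bounded_on (f + g).
Proof.
move=> [b Hb] [c Hc]; exists (b + c) => x Kx.
by rewrite (le_trans (ler_normD _ _)) // lerD ?Hb ?Hc.
Qed.

Lemma bounded_onZ c f : bounded_on f -> bounded_on (c *: f).
Proof.
by move=> [b Hb]; exists (`|c| * b) => x Kx; rewrite normrM ler_wpM2l // Hb.
Qed.

Lemma bounded_onM f g : bounded_on f -> bounded_on g -> bounded_on (fun x => f x * g x).
Proof.
move=> [b Hb] [c Hc]; exists (b * c) => x Kx.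
by rewrite normrM ler_pM // ?Hb ?Hc.
Qed.

Lemma bounded_on_cst c : bounded_on (fun=> c).
Proof. by exists `|c|. Qed.

(** Positivity refers to the values on K only, so that the functional ignores the
values elsewhere. *)
Record positive_functional (Lam : V -> R) : Prop := PositiveFunctional {
  pfunD : forall f g, bounded_on f -> bounded_on g -> Lam (f + g) = Lam f + Lam g;
  pfunZ : forall c f, bounded_on f -> Lam (c *: f) = c * Lam f;
  pfun_ge0 : forall f, bounded_on f -> (forall x, K x -> 0 <= f x) -> 0 <= Lam f }.

Hypothesis Kbd : forall p : A, bounded_on (peval p).

(** M. Riesz's extension theorem. The functions bounded below on K by a polynomial p
with L p >= 0 form a convex cone that does not contain -1 once L 1 > 0; a maximal
convex cone with these properties is a half-space, and L 1 times the functional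
defined by it agrees with L on the polynomials. When L 1 = 0, positivity forces
L = 0. *)
Lemma positive_extension (L : {scalar A}) :
  (forall p : A, (forall x, K x -> 0 <= peval p x) -> 0 <= L p) ->
  exists Lam, positive_functional Lam /\ forall p, Lam (peval p) = L p.
Proof.
move=> Lpos.
have LC c : L c%:A = c * L 1 by exact: linearZ.
have L1_ge0 : 0 <= L 1.
  by apply: Lpos => x _; rewrite -(scale1r 1) pevalC.
have Lbound (p : A) b : (forall x, K x -> `|peval p x| <= b) -> `|L p| <= b * L 1.
  move=> Hb; rewrite ler_norml -LC -subr_ge0 opprK -linearD -[X in _ && X]subr_ge0 -linearB.
  apply/andP; split; apply: Lpos => x /Hb; rewrite ler_norml => /andP[h1 h2].
    by rewrite pevalD pevalC -lerBlDr sub0r.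
  by rewrite pevalB pevalC subr_ge0.
have [L10|L1_neq0] := eqVneq (L 1) 0.
  exists (fun=> 0); split; first by split=> *; rewrite ?addr0 ?mulr0.
  move=> p; have [b Hb] := Kbd p; apply/esym/eqP; rewrite -normr_le0.
  by have := Lbound p b Hb; rewrite L10 mulr0.
have L1_gt0 : 0 < L 1 by rewrite lt_neqAle eq_sym L1_neq0.
pose e : V := fun=> 1.
pose convex_cone (M : set V) :=
  [/\ forall u v, M u -> M v -> M (u + v), forall c u, 0 <= c -> M u -> M (c *: u) & ~ M (- e)].
pose M0 : set V := [set g | exists p, 0 <= L p /\ forall x, K x -> peval p x <= g x].
have cM0 : convex_cone M0.
  split.
  - move=> u v [p [Lp pu]] [q [Lq qv]]; exists (p + q).
    rewrite linearD addr_ge0 //; split=> // x Kx; rewrite pevalD.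
    by apply: lerD; [exact: pu|exact: qv].
  - move=> c u c0 [p [Lp pu]]; exists (c *: p).
    rewrite linearZ mulr_ge0 //; split=> // x Kx; rewrite pevalZ.
    by apply: ler_wpM2l => //; exact: pu.
  - move=> [p [Lp pe]].
    have : 0 <= L ((-1)%:A - p).
      by apply: Lpos => x Kx; rewrite pevalB pevalC subr_ge0; exact: pe.
    by rewrite linearB LC /=; lra.
have [//|F [X0 FX0] FP FT Ftot|M [M0M cM Mmax]] := @Zorn_above V convex_cone M0.
  split=> [x y Fx Fy|c x c0 [X FX Xx]|[X FX Xx]].
  - have [Z [FZ Zx Zy]] := chain_pair Ftot Fx Fy; exists Z => //.
    by have [addZ _ _] := FP _ FZ; apply: addZ.
  - by exists X => //; have [_ mulX _] := FP _ FX; apply: mulX.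
  - by have [_ _] := FP _ FX; apply.
have [MD MZ MNe] := cM.
have zero_in : M 0.
  apply: M0M; exists 0; rewrite linear0; split=> // x _.
  by rewrite /peval rmorph0.
have adjoin v : ~ M v -> exists m c, [/\ M m, 0 <= c & - e = m + c *: v].
  move=> Mv; apply: contrapT => none; apply: Mv.
  have sub : M `<=` [set x | exists m (c : R), [/\ M m, 0 <= c & x = m + c *: v]].
    by move=> m Mm; exists m, 0; rewrite scale0r addr0.
  apply: (Mmax _ sub); last first.
    by exists 0, 1; rewrite scale1r add0r; split.
  split=> //.
  - move=> _ _ [m [c [Mm c0 ->]]] [m' [c' [Mm' c'0 ->]]].
    exists (m + m'), (c + c'); rewrite addr_ge0 // scalerDl addrACA; split=> //.
    exact: MD.
  - move=> b _ b0 [m [c [Mm c0 ->]]].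
    exists (b *: m), (b * c); rewrite mulr_ge0 // scalerDr scalerA; split=> //.
    exact: MZ.
(* -e = m + c v = m' - c' v combine to a positive multiple of -e in which v
     cancels, unless c = c' = 0 *)
have Mtot v : bounded_on v -> M v \/ M (- v).
  move=> _; have [|Mv] := pselect (M v); first by left.
  right; apply: contrapT => Mnv; apply: MNe.
  have [m [c [Mm c0 E]]] := adjoin _ Mv.
  have [m' [c' [Mm' c'0 E']]] := adjoin _ Mnv.
  have [cc|cc] := eqVneq (c + c') 0.
    have c00 : c = 0 by lra.
    by rewrite E c00 scale0r addr0.
  have -> : - e = (c + c')^-1 *: (c' *: m + c *: m').
    have -> : m = - e - c *: v by rewrite E addrK.
    have -> : m' = - e + c' *: v by rewrite E' -addrA scalerN addNr addr0.
    have -> : c' *: (- e - c *: v) + c *: (- e + c' *: v) = (c + c') *: - e.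
      by rewrite !scalerDr !scalerN !scalerA addrACA (mulrC c c') addNr addr0
        -opprD -scalerDl addrC.
    by rewrite scalerA mulVf // scale1r.
  apply: (MZ); first by rewrite invr_ge0 addr_ge0.
  by apply: MD; apply: MZ.
have Munit v : bounded_on v -> exists l : R, M (l *: e - v).
  move=> [b Hb]; exists b; apply: M0M; exists 0; rewrite linear0; split=> // x Kx.
  rewrite /peval rmorph0 -[leRHS]/(b * 1 - v x) mulr1 subr_ge0.
  exact: le_trans (ler_norm _) (Hb x Kx).
have De : bounded_on e by exact: bounded_on_cst.
pose phi := cone_functional M e.
have phiD : forall u v, bounded_on u -> bounded_on v -> phi (u + v) = phi u + phi v.
  exact: (@cone_functionalD R V bounded_on M e De bounded_onD bounded_onZ MD MZ MNe Mtot Munit).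
have phiZ : forall c v, bounded_on v -> phi (c *: v) = c * phi v.
  exact: (@cone_functionalZ R V bounded_on M e De bounded_onD bounded_onZ MD MZ MNe Mtot Munit).
have phi1 : phi e = 1.
  exact: (@cone_functional1 R V bounded_on M e De bounded_onZ MD MZ MNe Mtot Munit).
have phi_pos : forall v, bounded_on v -> M v -> 0 <= phi v.
  exact: (@cone_functional_pos R V bounded_on M e bounded_onZ MD MZ MNe Munit).
have L0_pos (p : A) : L p = 0 -> 0 <= phi (peval p).
  move=> Lp; apply: phi_pos => //; apply: M0M; exists p; rewrite Lp lexx.
  by split.
exists (fun v => L 1 * phi v); split.
  split=> [f g Hf Hg|c f Hf|f Hf f0].
  - by rewrite phiD // mulrDr.
  - by rewrite phiZ // mulrCA.
  - apply: mulr_ge0 => //; apply: phi_pos => //; apply: M0M; exists 0.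
    rewrite linear0; split=> // x Kx; rewrite /peval rmorph0.
    exact: f0.
move=> p; pose q := p - (L p / L 1)%:A.
have Lq : L q = 0 by rewrite linearB LC /= divfK // subrr.
have h1 := L0_pos _ Lq.
have h2 : 0 <= phi (peval (- q)) by apply: L0_pos; rewrite linearN Lq oppr0.
have e2 : peval (- q) = (-1) *: (peval q : V) :> V.
  by apply/funext => x; rewrite pevalN -[RHS]/(-1 * peval q x) mulN1r.
have phiq : phi (peval q) = 0.
  by apply/eqP; rewrite eq_le h1 andbT; move: h2; rewrite e2 phiZ // mulN1r oppr_ge0.
have -> : peval p = (peval q : V) + (L p / L 1) *: e :> V.
  apply/funext => x; rewrite -[RHS]/(peval q x + L p / L 1 * 1) /q pevalB pevalC.
  by rewrite mulr1 subrK.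
rewrite phiD //; last exact: bounded_onZ.
by rewrite phiq phiZ // phi1 add0r mulr1 mulrC divfK.
Qed.
End PositiveExtension.

(** * Nested cells and their masses *)

Section Cells.
Variables (R : realType) (d : nat) (K : set 'rV[R]_d).
Variable Lam : ('rV[R]_d -> R^o) -> R.
Hypothesis LamP : positive_functional K Lam.
Local Notation A := (polyring R d).

(** An enumeration of the half-spaces with rational coordinate bounds; the whole
space stands for the numbers that code no such bound. *)
Definition test (n : nat) : set 'rV[R]_d :=
  if unpickle n is Some iq then [set x | x ord0 (iq : 'I_d * rat).1 < ratr iq.2]
  else setT.

(** The binary tree of subsets of K cut out by the first tests. A word lists the
outcomes with the latest first, so that the children of w are the words b :: w. *)
Fixpoint cell (w : seq bool) : set 'rV[R]_d :=
  if w is b :: w' then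
    cell w' `&` (if b then test (size w') else ~` test (size w'))
  else K.

Definition mass (w : seq bool) : R := Lam \1_(cell w).

(** The slot of a cell is divided between the two halves of the cell in proportion to
their masses, the half that passes the test on the left. *)
Fixpoint left_end (w : seq bool) : R :=
  match w with
  | [::] => 0
  | true :: w' => left_end w'
  | false :: w' => left_end w' + mass (true :: w')
  end.

Definition slot (w : seq bool) : set R :=
  [set t | left_end w <= t < left_end w + mass w].

(** The outcomes of the first n tests for the cells whose slots contain t. *)
Fixpoint address (t : R) (n : nat) : seq bool :=
  if n is n'.+1 then
    let w := address t n' in (t < left_end w + mass (true :: w)) :: w
  else [::].

Lemma bounded_on_indic (B : set 'rV[R]_d) : bounded_on K (\1_B : _ -> R).
Proof. by exists 1 => x _; rewrite indicE normr_nat; case: (_ \in _). Qed.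

Lemma cell_sub b w : cell (b :: w) `<=` cell w. Proof. by move=> x []. Qed.

Lemma cell_subK w : cell w `<=` K.
Proof. by elim: w => //= b w IH x [/IH]. Qed.

Lemma split_indic w (f : 'rV[R]_d -> R) : (fun x => f x * \1_(cell w) x) =
  (fun x => f x * \1_(cell (true :: w)) x) + (fun x => f x * \1_(cell (false :: w)) x) :> (_ -> R^o).
Proof.
apply/funext => x; rewrite -[RHS]/(f x * \1_(cell (true :: w)) x + f x * \1_(cell (false :: w)) x).
rewrite -mulrDr !indicE; congr (_ * _).
have [xw|xw] := boolP (x \in cell w); last first.
  rewrite !memNset ?addr0 //= => -[h _]; apply: (negP xw); exact: mem_set.
move/set_mem : xw => xw.
have [xt|xt] := pselect (test (size w) x).
  by rewrite mem_set // memNset ?addr0 //= => -[].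
by rewrite memNset ?mem_set ?add0r //= => -[].
Qed.

Lemma mass_split w : mass w = mass (true :: w) + mass (false :: w).
Proof.
have e (B : set 'rV[R]_d) : (\1_B : _ -> R^o) = (fun x => 1 * \1_B x).
  by apply/funext => x; rewrite mul1r.
rewrite /mass e split_indic -!e (pfunD LamP) //; exact: bounded_on_indic.
Qed.

Lemma mass_ge0 w : 0 <= mass w.
Proof. by apply: (pfun_ge0 LamP) => //; exact: bounded_on_indic. Qed.

(** Only a cell of positive mass has a nonempty slot, so every parameter belongs to
slots of nonempty cells. *)
Lemma mass_nonempty w : 0 < mass w -> cell w !=set0.
Proof.
move=> mw; apply/set0P/negP => /eqP w0; move: mw; rewrite /mass w0 indic0.
have -> : (cst 0 : _ -> R^o) = 0 *: (cst 0 : 'rV[R]_d -> R^o).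
  by rewrite scale0r.
by rewrite (pfunZ LamP) ?mul0r ?ltxx //; exact: bounded_on_cst.
Qed.

Lemma slot_split w : slot w = slot (true :: w) `|` slot (false :: w).
Proof.
apply/seteqP; split=> t; rewrite /slot /= (mass_split w).
  move=> /andP[h1 h2]; have [h|h] := ltP t (left_end w + mass (true :: w)); [left|right].
    by rewrite /= h1.
  by rewrite -addrA h2.
have := mass_ge0 (true :: w); have := mass_ge0 (false :: w).
by move=> m1 m2 [] /andP[h1 h2]; apply/andP; split; lra.
Qed.

Lemma slot_disjoint w : slot (true :: w) `&` slot (false :: w) = set0.
Proof. by apply/seteqP; split=> // t; rewrite /slot /= => -[]; lra. Qed.

Lemma slot_address t n : slot [::] t -> slot (address t n) t.
Proof.
move=> t0; elim: n => //= n; rewrite {1}slot_split.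
case: ltP => h [] // /andP[/= h1 h2]; exfalso.
  by move: h; rewrite ltNge h1.
by move: h; rewrite leNgt h2.
Qed.

Lemma slot_sub0 w : slot w `<=` slot [::].
Proof.
elim: w => //= b w IH; apply: subset_trans IH; rewrite [slot w]slot_split.
by case: b; [left|right].
Qed.

Lemma address_slot w t : slot w t -> address t (size w) = w.
Proof.
elim: w => //= b w IH tw; have tw' : slot w t.
  by rewrite slot_split; case: b tw; [left|right].
rewrite IH //; congr cons; move: tw; rewrite /slot /=.
by case: b => /andP[h1 h2]; rewrite ?h2 // ltNge h1.
Qed.

Lemma size_address t n : size (address t n) = n.
Proof. by elim: n => //= n ->. Qed.

Lemma cell_address t n m : (n <= m)%N -> cell (address t m) `<=` cell (address t n).
Proof.
move=> /subnKC <-; elim: (m - n)%N => [|k IH]; first by rewrite addn0.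
by rewrite addnS; apply: subset_trans IH; apply: cell_sub.
Qed.

Lemma cell_address_nonempty t n : slot [::] t -> cell (address t n) !=set0.
Proof.
move=> /(slot_address n); rewrite /slot /= => /andP[h1 h2].
by apply: mass_nonempty; lra.
Qed.

Lemma cell_test w n x y : cell w x -> cell w y -> (n < size w)%N ->
  test n x -> test n y.
Proof.
elim: w => //= b w IH [wx bx] [wy by_]; rewrite ltnS leq_eqVlt => /predU1P[->|].
  by case: b bx by_.
exact: IH.
Qed.

Definition small_oscillation (g : 'rV[R]_d -> R) :=
  forall eps, 0 < eps -> exists n, forall w, (n <= size w)%N ->
    forall x y, cell w x -> cell w y -> `|g x - g y| <= eps.

(** The tests include comparisons of the coordinate with all points of spacing 1/k in
a bounded range; a cell that has passed these tests cannot contain two points at a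
distance more than 1/k in this coordinate. *)
Lemma small_oscillation_coord i : bounded_on K (fun x => x ord0 i) ->
  small_oscillation (fun x => x ord0 i).
Proof.
move=> [b Hb] eps eps0.
pose k := (Num.truncn eps^-1).+1; pose delta : R := k%:R^-1.
have delta0 : 0 < delta by rewrite invr_gt0.
have delta_eps : delta <= eps.
  by rewrite -[eps]invrK lef_pV2 ?posrE ?invr_gt0 //; apply/ltW/truncnS_gt.
pose N := (Num.truncn (`|b| * k%:R)).+1.
pose grid := [seq ((j%:Z - N%:Z)%:~R / k%:R : rat) | j <- iota 0 (N + N)].
exists (\max_(q <- grid) (pickle (i, q)).+1) => w nw x y wx wy.
wlog xy : x y wx wy / x ord0 i <= y ord0 i.
  move=> H; have [|/ltW] := leP (x ord0 i) (y ord0 i); first exact: H.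
  by rewrite distrC; exact: H.
rewrite distrC ger0_norm ?subr_ge0 // leNgt; apply/negP => lt_eps.
(* the grid point j / k separates x from y when they are further apart than 1 / k *)
pose j := Num.floor (y ord0 i * k%:R).
have k0 : 0 < k%:R :> R by rewrite ltr0n.
have /andP[j1 j2] : j%:~R <= y ord0 i * k%:R < (j + 1)%:~R by exact: floor_itv.
have yN : `|y ord0 i * k%:R| < N%:R.
  rewrite normrM (ger0_norm (ltW k0)).
  apply: le_lt_trans (truncnS_gt _); rewrite ler_wpM2r ?ler0n //.
  by apply: le_trans (ler_norm b); apply: Hb; exact: cell_subK wy.
move: yN; rewrite ltr_norml => /andP[yN1 yN2].
have jN1 : - N%:Z <= j.
  by rewrite -ltzD1 -(ltr_int R) (lt_trans _ j2) // rmorphN.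
have jN2 : j < N%:Z by rewrite -(ltr_int R) (le_lt_trans j1).
pose q : rat := j%:~R / k%:R.
have qin : q \in grid.
  apply/mapP; exists (absz (j + N%:Z)); first by rewrite mem_iota; lia.
  by rewrite gez0_abs ?addrK //; lia.
have qR : ratr q = j%:~R / k%:R :> R by rewrite fmorph_div rmorph_int rmorph_nat.
have lt_q : (pickle (i, q) < size w)%N.
  by apply: leq_trans nw; rewrite (big_rem q qin) /= leq_maxl.
have xq : test (pickle (i, q)) x.
  rewrite /test pickleK /= qR ltr_pdivlMr //.
  have : (y ord0 i - x ord0 i) * k%:R > 1.
    rewrite -ltr_pdivrMr // mul1r; apply: le_lt_trans delta_eps lt_eps.
  by move: j2; rewrite intrD mulrBl; lra.
have := cell_test wx wy lt_q xq; rewrite /test pickleK /= qR.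
by rewrite ltNge ler_pdivrMr // j1.
Qed.

End Cells.

(** * The limit map from parameters to points *)

Lemma peval_continuous (R : realType) (d : nat) (p : polyring R d) :
  continuous (peval p : 'rV[R]_d -> R).
Proof.
move: p; apply: polyring_ind.
- move=> c x; rewrite (_ : peval _ = fun=> c); first exact: cst_continuous.
  by apply/funext => y; rewrite pevalC.
- move=> i x; rewrite (_ : peval _ = fun y => y ord0 i); first exact: coord_continuous.
  by apply/funext => y; rewrite pevalX.
- move=> p q cp cq x; rewrite (_ : peval _ = fun y => peval p y + peval q y).
    exact: (cvgD (cp x) (cq x)).
  by apply/funext => y; rewrite pevalD.
- move=> p q cp cq x; rewrite (_ : peval _ = fun y => peval p y * peval q y).
    exact: (cvgM (cp x) (cq x)).
  by apply/funext => y; rewrite pevalM.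
Qed.

Section Limit.
Variables (R : realType) (d : nat) (K : set 'rV[R]_d).
Variable Lam : ('rV[R]_d -> R^o) -> R.
Hypothesis LamP : positive_functional K Lam.
Hypothesis cK : compact K.
Local Notation A := (polyring R d).

Lemma compact_coord_bounded i : bounded_on K (fun x => x ord0 i).
Proof.
have [M [Mr HM]] := compact_bounded cK; exists (`|M| + 1) => x Kx.
apply: le_trans (le_coord_norm x i) _; apply: (HM _ _ x Kx).
by rewrite (le_lt_trans (ler_norm M)) // ltrDl.
Qed.

(** Boundedness and small oscillation on deep cells are proved together, since the
oscillation of a product is estimated through the bounds of the factors. *)
Lemma peval_bounded_oscillation (p : A) :
  bounded_on K (peval p) /\ small_oscillation K (peval p).
Proof.
move: p; apply: polyring_ind.
- move=> c; have -> : peval (c%:A : A) = fun=> c by apply/funext => x; rewrite pevalC.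
  split; first exact: bounded_on_cst.
  by move=> eps /ltW eps0; exists 0%N => w _ x y _ _; rewrite subrr normr0.
- move=> i; have -> : peval (mpoly.mpolyX R (mpoly.mnm1 i) : A) = fun x => x ord0 i.
    by apply/funext => x; rewrite pevalX.
  by split; [|apply: small_oscillation_coord]; exact: compact_coord_bounded.
- move=> p q [bp op] [bq oq].
  have -> : peval (p + q) = (fun x => peval p x + peval q x).
    by apply/funext => x; rewrite pevalD.
  split; first exact: bounded_onD.
  move=> eps eps0; have h2 : 0 < eps / 2 by rewrite divr_gt0.
  have [n Hn] := op _ h2; have [m Hm] := oq _ h2.
  exists (maxn n m) => w; rewrite geq_max => /andP[nw mw] x y wx wy.
  rewrite opprD addrACA [leRHS]splitr.
  by apply: le_trans (ler_normD _ _) _; apply: lerD; [exact: Hn wx wy|exact: Hm wx wy].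
- move=> p q [bp op] [bq oq].
  have -> : peval (p * q) = (fun x => peval p x * peval q x).
    by apply/funext => x; rewrite pevalM.
  split; first exact: bounded_onM.
  move=> eps eps0; have [[b Hb] [c Hc]] := (bp, bq).
  pose e := eps / (`|b| + `|c| + 1).
  have bc : 0 < `|b| + `|c| + 1 by rewrite ltr_wpDl // addr_ge0.
  have e0 : 0 < e by rewrite divr_gt0.
  have [n Hn] := op _ e0; have [m Hm] := oq _ e0.
  exists (maxn n m) => w; rewrite geq_max => /andP[nw mw] x y wx wy.
  have px : `|peval p x| <= `|b|.
    by apply: le_trans (ler_norm b); apply: Hb; exact: cell_subK wx.
  have qy : `|peval q y| <= `|c|.
    by apply: le_trans (ler_norm c); apply: Hc; exact: cell_subK wy.
  have -> : peval p x * peval q x - peval p y * peval q y =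
    peval p x * (peval q x - peval q y) + peval q y * (peval p x - peval p y) by ring.
  apply: le_trans (ler_normD _ _) _; rewrite !normrM.
  have h1 := Hn w nw x y wx wy; have h2 := Hm w mw x y wx wy.
  have h3 : `|peval p x| * `|peval q x - peval q y| <= `|b| * e by exact: ler_pM.
  have h4 : `|peval q y| * `|peval p x - peval p y| <= `|c| * e by exact: ler_pM.
  apply: le_trans (lerD h3 h4) _; rewrite -mulrDl.
  have -> : eps = (`|b| + `|c| + 1) * e by rewrite mulrC divfK // gt_eqF.
  by rewrite ler_wpM2r ?ltW // ltrDl.
Qed.

(** An arbitrary point of each cell containing the parameter; by small oscillation
these points form a Cauchy sequence. Parameters outside the root slot carry no
mass, and the origin stands for their points. *)
Definition approx (t : R) (n : nat) : 'rV[R]_d :=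
  if `[< slot K Lam [::] t >] then get (cell K (address K Lam t n)) else 0.

Lemma approx_cell t n : slot K Lam [::] t -> cell K (address K Lam t n) (approx t n).
Proof.
move=> st; rewrite /approx; case: asboolP => // _.
have [x cx] := cell_address_nonempty LamP n st.
exact: (getI (x:=x)).
Qed.

Lemma approx_cvg t : cvg (approx t @ \oo).
Proof.
have [st|st] := pselect (slot K Lam [::] t); last first.
  have -> : approx t = fun=> 0 by apply/funext => n; rewrite /approx; case: asboolP.
  exact: is_cvg_cst.
apply/cauchy_cvgP/cauchy_exP => e e0.
have osc i : exists n, forall w, (n <= size w)%N -> forall x y : 'rV[R]_d,
    cell K w x -> cell K w y -> `|x ord0 i - y ord0 i| <= e / 2.
  by apply: small_oscillation_coord (compact_coord_bounded i) _ _; rewrite divr_gt0.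
have [N HN] := choice osc.
pose n := \max_i N i; exists (approx t n); exists n => // m /= nm.
split=> // i j; rewrite [i]ord1 /ball /=.
have nN : (N j <= n)%N by exact: leq_bigmax.
apply: (@le_lt_trans _ _ (e / 2)); last by rewrite ltr_pdivrMr // ltr_pMr // ltr1n.
apply: (HN j (address K Lam t n)); first by rewrite size_address.
  exact: approx_cell.
by apply: (cell_address (m := m)) => //; exact: approx_cell.
Qed.

Definition limit_point (t : R) : 'rV[R]_d := lim (approx t @ \oo).

(** The limit of chosen points need not lie in the cells themselves, which are neither
open nor closed; it lies in K, and polynomials at the limit differ little from their
values on the cells ([limit_point_oscillation]). *)
Lemma limit_pointP t : approx t @ \oo --> limit_point t.
Proof. exact: approx_cvg. Qed.

Lemma limit_point_in t : slot K Lam [::] t -> K (limit_point t).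
Proof.
move=> st; apply: (closed_cvg _ _ _ _ (@limit_pointP t)).
  exact: compact_closed.
by near=> n; apply: cell_subK; apply: approx_cell.
Unshelve. all: by end_near. Qed.

Lemma limit_point_oscillation (p : A) eps n :
  (forall w, (n <= size w)%N -> forall x y, cell K w x -> cell K w y ->
    `|peval p x - peval p y| <= eps) ->
  forall w t x, (n <= size w)%N -> slot K Lam w t -> cell K w x ->
  `|peval p (limit_point t) - peval p x| <= eps.
Proof.
move=> osc w t x nw st wx.
have st0 : slot K Lam [::] t := slot_sub0 LamP st.
have cv : (fun k => `|peval p (approx t k) - peval p x|) @ \oo -->
    `|peval p (limit_point t) - peval p x|.
  apply: cvg_norm; apply: cvgB; last exact: cvg_cst.
  by apply: continuous_cvg (limit_pointP (t:=t)); exact: peval_continuous.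
rewrite -(cvg_lim _ cv) //; apply: limr_le; first by apply/cvg_ex; eexists; exact: cv.
near=> k; apply: (osc w) => //.
rewrite -(address_slot LamP st); apply: (cell_address (m := k)); last exact: approx_cell.
by near: k; exact: nbhs_infty_ge.
Unshelve. all: by end_near. Qed.

End Limit.

(** * Integrals along the limit map *)

Section Measure.
Variables (R : realType) (d : nat) (K : set 'rV[R]_d).
Variable Lam : ('rV[R]_d -> R^o) -> R.
Hypothesis LamP : positive_functional K Lam.
Hypothesis cK : compact K.
Local Notation A := (polyring R d).
Local Notation slot := (slot K Lam).
Local Notation mass := (mass K Lam).
Local Notation address := (address K Lam).
Local Notation cell := (cell K).
Local Notation approx := (approx K Lam).
Local Notation limit_point := (limit_point K Lam).

Lemma slot_itv w : slot w =
  `[left_end K Lam w, left_end K Lam w + mass w[%classic.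
Proof. by apply/seteqP; split=> t /=; rewrite in_itv. Qed.

Lemma measurable_slot w : measurable (slot w).
Proof. by rewrite slot_itv; exact: measurable_itv. Qed.

Lemma measurable_address (Q : seq bool -> Prop) n :
  measurable [set t | slot [::] t /\ Q (address t n)].
Proof.
pose F k : set R := if unpickle k is Some w then
  [set t | slot w t /\ (size w = n /\ Q w)] else set0.
have -> : [set t | slot [::] t /\ Q (address t n)] = \bigcup_k F k.
  apply/seteqP; split=> [t [st Qt]|t [k _]].
    exists (pickle (address t n)) => //; rewrite /F pickleK /= size_address.
    by split=> //; exact: (slot_address LamP).
  rewrite /F; case: unpickle => // w [st [<- Qw]].
  by rewrite /= (address_slot LamP st); split=> //; exact: (slot_sub0 LamP st).
apply: bigcup_measurable => k _; rewrite /F; case: unpickle => // w.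
have [h|h] := pselect (size w = n /\ Q w).
  rewrite (_ : [set t | _] = slot w); first exact: measurable_slot.
  by apply/seteqP; split=> t // [].
rewrite (_ : [set t | _] = set0) //.
by apply/seteqP; split=> t // [].
Qed.

(** The n-th approximation takes one value on each slot of depth n, and the slots are
countable in number. *)
Lemma measurable_approx (U : set 'rV[R]_d) n : measurable [set t | U (approx t n)].
Proof.
pose Q w := U (get (cell w)).
have -> : [set t | U (approx t n)] =
    [set t | slot [::] t /\ Q (address t n)] `|` (~` slot [::] `&` [set t | U 0]).
  apply/seteqP; split=> t /=; rewrite /approx /Q; case: asboolP => st.
  - by left.
  - by right.
  - by move=> [[]|[]].
  - by move=> [[]|[]].
apply: measurableU; first exact: measurable_address.
apply: measurableI; first by apply: measurableC; exact: measurable_slot.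
have [U0|U0] := pselect (U 0).
  rewrite (_ : [set t | _] = setT); first exact: measurableT.
  by apply/seteqP; split=> t.
rewrite (_ : [set t | _] = set0); first exact: measurable0.
by apply/seteqP; split=> t.
Qed.

(** The limit lies in an open U if and only if, for some k, the balls of radius
1 / (k + 1) around the approximations are eventually contained in U; this writes the
preimage of U by countable unions and intersections. *)
Lemma measurable_limit_point :
  measurable_fun [set: measurableTypeR R] (limit_point : measurableTypeR R -> borelRd R d).
Proof.
apply: (@measurability _ _ (measurableTypeR R) (borelRd R d) setT limit_point (@open 'rV[R]_d)) => //.
move=> _ [U oU <-]; rewrite setTI.
pose B k (x : 'rV[R]_d) := ball x k.+1%:R^-1 `<=` U.
have -> : limit_point @^-1` U =
    \bigcup_k \bigcup_N \bigcap_(n in [set n | (N <= n)%N]) [set t | B k (approx t n)].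
  apply/seteqP; split=> [t Ut|t [k _ [N _ HN]]].
    have /nbhs_ballP[e /= e0 eU] : nbhs (limit_point t) U by exact: open_nbhs_nbhs.
    have e2 : 0 < e / 2 by rewrite divr_gt0.
    have [k ke] : exists k, k.+1%:R^-1 <= e / 2.
      exists (Num.truncn (e / 2)^-1); rewrite -[leRHS]invrK lef_pV2 ?posrE ?invr_gt0 //.
      exact/ltW/truncnS_gt.
    have /cvg_ball/(_ _ e2) := limit_pointP LamP cK (t := t).
    move=> [N _ HN]; exists k => //; exists N => // n /= Nn y yb.
    apply: eU; apply: ball_split (HN n Nn) _.
    exact: le_ball ke _ yb.
  have /cvg_ball/(_ k.+1%:R^-1) := limit_pointP LamP cK (t := t).
  rewrite invr_gt0 ltr0n => /(_ isT)[M _ HM].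
  apply: (HN (maxn N M)); first by rewrite /= leq_maxl.
  by apply: ball_sym; apply: HM; rewrite /= leq_maxr.
apply: bigcup_measurable => k _; apply: bigcup_measurable => N _.
by apply: bigcap_measurable => [|n _]; [exists N => /=|exact: measurable_approx].
Qed.

Definition slot_measure : {measure set (measurableTypeR R) -> \bar R} :=
  mrestr (@lebesgue_measure R) (measurable_slot [::]).

Lemma slot_measureE w : slot_measure (slot w) = (mass w)%:E.
Proof.
rewrite /slot_measure /= /mrestr setIidl; last exact: (slot_sub0 LamP).
rewrite slot_itv lebesgue_measure_itv /= lte_fin ltrDl.
have [m0|] := ltP 0 (mass w); first by rewrite -EFinB addrC addKr.
by move=> m0; congr EFin; apply/eqP; rewrite eq_le m0 (mass_ge0 LamP).
Qed.

Lemma slot_measure_fin (B : set R) : measurable B -> (slot_measure B < +oo)%E.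
Proof.
move=> mB; apply: (@le_lt_trans _ _ (slot_measure (slot [::]))).
  rewrite /slot_measure /= /mrestr setIid; apply: le_measure; rewrite ?inE //.
    by apply: measurableI => //; exact: measurable_slot.
  exact: measurable_slot.
by rewrite slot_measureE ltry.
Qed.

Lemma Rintegral_close (D : set R) (f : R -> R) (a eps : R) : measurable D ->
  slot_measure.-integrable D (EFin \o f) -> (forall t, D t -> `|f t - a| <= eps) ->
  `|\int[slot_measure]_(t in D) f t - a * fine (slot_measure D)| <=
  eps * fine (slot_measure D).
Proof.
move=> mD fi fa.
have ci c : slot_measure.-integrable D (EFin \o cst c).
  apply: measurable_bounded_integrable => //; first exact: slot_measure_fin.
  by exists `|c|; split; [exact: num_real|move=> x /ltW cx t _].
have up : \int[slot_measure]_(t in D) f t <= \int[slot_measure]_(t in D) cst (a + eps) t.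
  by apply: le_Rintegral => // t /fa; rewrite ler_norml /cst; lra.
have lo : \int[slot_measure]_(t in D) cst (a - eps) t <= \int[slot_measure]_(t in D) f t.
  by apply: le_Rintegral => // t /fa; rewrite ler_norml /cst; lra.
move: up lo; rewrite !Rintegral_cst // => up lo.
rewrite ler_norml; apply/andP; split; lra.
Qed.

Lemma limit_point_out t : ~ slot [::] t -> limit_point t = 0.
Proof.
move=> st; rewrite /limit_point (_ : approx t = fun=> 0) ?lim_cst //.
by apply/funext => n; rewrite /approx; case: asboolP.
Qed.

Section Polynomial.
Variable p : A.
Let f t := peval p (limit_point t).

Lemma measurable_peval : measurable_fun [set: borelRd R d] (peval p : borelRd R d -> R).
Proof.
apply: (measurability _ (measurable_realfun.RGenOInfty.measurableE R)).
move=> _ [_ [a ->] <-]; rewrite setTI; apply: sub_sigma_algebra.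
by apply: open_comp => [x _|]; [exact: peval_continuous|exact: interval_open].
Qed.

Lemma measurable_peval_limit : measurable_fun [set: measurableTypeR R] f.
Proof. exact: (measurableT_comp measurable_peval measurable_limit_point). Qed.

Lemma peval_limit_bounded : exists b, 0 <= b /\ forall t, `|f t| <= b.
Proof.
have [[b Hb] _] := peval_bounded_oscillation cK p.
exists (`|b| + `|peval p 0|); split; first by rewrite addr_ge0.
move=> t; have [st|st] := pselect (slot [::] t).
  apply: ler_wpDr => //; apply: le_trans (ler_norm b).
  by apply: Hb; exact: limit_point_in.
by rewrite /f limit_point_out // lerDr.
Qed.

Lemma integrable_peval_limit (D : set R) : measurable D ->
  slot_measure.-integrable D (EFin \o f).
Proof.
move=> mD; apply: measurable_bounded_integrable => //; first exact: slot_measure_fin.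
  exact: measurable_funS measurable_peval_limit.
have [b [b0 Hb]] := peval_limit_bounded.
exists b; split; first exact: num_real.
by move=> x /ltW bx t _; exact: le_trans (Hb t) bx.
Qed.

Lemma pfun_le (g h : 'rV[R]_d -> R^o) : bounded_on K g -> bounded_on K h ->
  (forall x, K x -> g x <= h x) -> Lam g <= Lam h.
Proof.
move=> bg bh gh; have bNg := bounded_onZ (-1) bg.
have : 0 <= Lam (h + (-1) *: g).
  apply: (pfun_ge0 LamP); first exact: bounded_onD.
  by move=> x Kx; rewrite -[leRHS]/(h x + -1 * g x) mulN1r subr_ge0; exact: gh.
by rewrite (pfunD LamP) // (pfunZ LamP) // mulN1r subr_ge0.
Qed.

Let E w := Lam (fun x => peval p x * \1_(cell w) x).

(** Let a be a value of p on a deep cell of mass m. The integral over the slot and the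
value of Lam on the restriction of p to the cell both differ from a m by at most
eps m. These two quantities and the error bound are additive when a
cell is divided, which carries the estimate up from the deep cells to every cell. *)
Lemma slot_integral_close eps n :
  (forall w, (n <= size w)%N -> forall x y, cell w x -> cell w y ->
    `|peval p x - peval p y| <= eps) ->
  forall w, `|\int[slot_measure]_(t in slot w) f t - E w| <= 2 * eps * mass w.
Proof.
move=> osc.
have bp : bounded_on K (peval p) by have [] := peval_bounded_oscillation cK p.
have bi w : bounded_on K (\1_(cell w) : _ -> R^o) by exact: bounded_on_indic.
have bpi w : bounded_on K (fun x => peval p x * \1_(cell w) x).
  exact: bounded_onM bp (bi w).
have leaf w : (n <= size w)%N ->
    `|\int[slot_measure]_(t in slot w) f t - E w| <= 2 * eps * mass w.
  move=> nw; pose a := peval p (get (cell w)).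
  have h1 := @Rintegral_close (slot w) f a eps (measurable_slot w)
    (integrable_peval_limit (measurable_slot w)).
  rewrite slot_measureE /= in h1.
  have {}h1 : `|\int[slot_measure]_(t in slot w) f t - a * mass w| <= eps * mass w.
    apply: h1 => t st; apply: (limit_point_oscillation LamP cK osc nw st).
    have [|x cx] := @mass_nonempty _ _ _ _ LamP w.
      by move: st; rewrite /slot /= => /andP[]; lra.
    exact: getI cx.
  have close x : cell w x -> `|peval p x - a| <= eps.
    by move=> cx; apply: osc (getI cx).
  have h2 : E w <= (a + eps) * mass w.
    rewrite -(pfunZ LamP) //; apply: pfun_le => // [|x Kx]; first exact: bounded_onZ.
    rewrite -[leRHS]/((a + eps) * \1_(cell w) x) indicE.
    have [/set_mem/close|_] := boolP (x \in cell w); last by rewrite !mulr0.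
    by rewrite ler_norml !mulr1; lra.
  have h3 : (a - eps) * mass w <= E w.
    rewrite -(pfunZ LamP) //; apply: pfun_le => // [|x Kx]; first exact: bounded_onZ.
    rewrite -[leLHS]/((a - eps) * \1_(cell w) x) indicE.
    have [/set_mem/close|_] := boolP (x \in cell w); last by rewrite !mulr0.
    by rewrite ler_norml !mulr1; lra.
  move: h1; rewrite !ler_norml => /andP[h11 h12]; apply/andP; split; lra.
(* induction on the number k of levels between w and depth n *)
have descend k w : (n <= size w + k)%N ->
    `|\int[slot_measure]_(t in slot w) f t - E w| <= 2 * eps * mass w.
  elim: k w => [|k IH] w nwk; first by apply: leaf; rewrite -(addn0 (size w)).
  have It := IH (true :: w); have If := IH (false :: w).
  rewrite /= addSnnS in It; rewrite /= addSnnS in If.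
  have -> : \int[slot_measure]_(t in slot w) f t =
      \int[slot_measure]_(t in slot (true :: w)) f t +
      \int[slot_measure]_(t in slot (false :: w)) f t.
    rewrite {1}(slot_split LamP w) Rintegral_setU //.
    + exact: measurable_slot.
    + exact: measurable_slot.
    + rewrite -(slot_split LamP w); apply: integrable_peval_limit.
      exact: measurable_slot.
    + by apply/disj_setPS; rewrite slot_disjoint.
  have -> : E w = E (true :: w) + E (false :: w).
    by rewrite /E split_indic (pfunD LamP).
  rewrite (mass_split LamP w) mulrDr opprD addrACA.
  by apply: le_trans (ler_normD _ _) _; apply: lerD; [exact: It|exact: If].
by move=> w; apply: (descend n); rewrite leq_addl.
Qed.

Lemma limit_integral : \int[slot_measure]_t f t = Lam (peval p).
Proof.
have bp : bounded_on K (peval p) by have [] := peval_bounded_oscillation cK p.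
have m0 := measurable_slot [::].
have out : \int[slot_measure]_(t in ~` slot [::]) f t = 0.
  have [b [b0 Hb]] := peval_limit_bounded.
  have mC := measurableC m0.
  have := @Rintegral_close (~` slot [::]) f 0 b mC (integrable_peval_limit mC).
  have -> : slot_measure (~` slot [::]) = 0%E.
    by rewrite /slot_measure /= /mrestr setICl measure0.
  rewrite /= !mulr0 subr0 => h; apply/eqP; rewrite -normr_le0; apply: h.
  by move=> t _; rewrite subr0.
have -> : \int[slot_measure]_t f t = \int[slot_measure]_(t in slot [::]) f t.
  rewrite -(setUv (slot [::])) Rintegral_setU ?out ?addr0 //.
  - exact: measurableC.
  - by rewrite setUv; exact: integrable_peval_limit.
  - by apply/disj_setPS; rewrite setICr.
have -> : Lam (peval p) = E [::].
  have bpi := bounded_onM bp (@bounded_on_indic _ _ K (cell [::])).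
  apply/eqP; rewrite eq_le; apply/andP; split; apply: pfun_le => // x Kx;
    by rewrite indicE mem_set // mulr1.
apply/eqP; rewrite -subr_eq0 -normr_le0; apply/ler_addgt0Pr => eps eps0; rewrite add0r.
have c0 : 0 < 2 * mass [::] + 1 by rewrite ltr_wpDl // mulr_ge0 // (mass_ge0 LamP).
have [n Hn] := (peval_bounded_oscillation cK p).2 _ (divr_gt0 eps0 c0).
apply: le_trans (slot_integral_close Hn [::]) _.
rewrite mulrAC mulrA ler_pdivrMr // mulrC ler_wpM2l ?ltW //; lra.
Qed.

End Polynomial.

End Measure.

(** * Regularity of finite Borel measures *)

Section Regularity.
Variables (R : realType) (d : nat) (mu : {measure set (borelRd R d) -> \bar R}).
Hypothesis mu_fin : (mu setT < +oo)%E.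
Local Notation X := 'rV[R]_d.

Lemma open_borel (U : set X) : open U -> measurable (U : set (borelRd R d)).
Proof. exact: sub_sigma_algebra. Qed.

Lemma closed_borel (F : set X) : closed F -> measurable (F : set (borelRd R d)).
Proof. by move=> cF; rewrite -[F]setCK; apply: measurableC; apply: open_borel; exact: closed_openC. Qed.

Lemma mu_lty (B : set (borelRd R d)) : measurable B -> (mu B < +oo)%E.
Proof. by move=> mB; apply: le_lt_trans mu_fin; apply: le_measure; rewrite ?inE. Qed.

(** Continuity from above of a finite measure. *)
Lemma eventually_small (D : (set (borelRd R d))^nat) (e : \bar R) :
  (forall n, measurable (D n)) -> {homo D : m n / (m <= n)%N >-> (n <= m)%O} ->
  (mu (\bigcap_n D n) < e)%E -> exists n, (mu (D n) < e)%E.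
Proof.
move=> mD decD De.
have := nonincreasing_cvg_mu (mu_lty (mD 0%N)) mD (bigcapT_measurable mD) decD.
move=> /(@cvg_lim _ _) H.
have H' : lim (mu \o D @ \oo) = mu (\bigcap_n D n) by exact: H.
apply: contrapT => none; move: De; rewrite -H' ltNge => /negP; apply.
apply: lime_ge; first by apply/cvg_ex; eexists; exact: nonincreasing_cvg_mu (mu_lty (mD 0%N)) mD (bigcapT_measurable mD) decD.
by near=> n; rewrite leNgt; apply/negP => h; apply: none; exists n.
Unshelve. all: by end_near. Qed.

(** Regularity from inside and outside at once, a condition symmetric under
complements. *)
Definition sandwiched (B : set X) := forall e : R, 0 < e -> exists F U : set X,
  [/\ closed F, open U, F `<=` B, B `<=` U & (mu (U `\` F) < e%:E)%E].

(** An open set is the increasing union of the closed sets of the points that are not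
in the interior of a ball of radius 1 / (k + 1) around a point outside it. *)
Lemma open_sandwiched (U : set X) : open U -> sandwiched U.
Proof.
move=> oU e e0; pose F k : set X := ~` \bigcup_(y in ~` U) (ball y k.+1%:R^-1)°.
have cF k : closed (F k).
  by apply: open_closedC; apply: bigcup_open => y _; exact: open_interior.
have FU k : F k `<=` U.
  move=> x Fx; apply: contrapT => Ux; apply: Fx; exists x => //.
  by apply: nbhsx_ballx; rewrite invr_gt0.
have [n Hn] : exists n, (mu (U `\` F n) < e%:E)%E.
  apply: eventually_small.
  - by move=> n; apply: measurableD; [exact: open_borel|exact: closed_borel].
  - move=> m n mn; apply/subsetPset => x [Ux nFx]; split=> // Fx; apply: nFx.
    move=> [y Uy yx]; apply: Fx; exists y => //; apply: filterS yx => z.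
    by apply: le_ball; rewrite lef_pV2 ?posrE // ler_nat.
  - rewrite (_ : \bigcap_n _ = set0) ?measure0 ?lte_fin //.
    apply/seteqP; split=> // x Hx; have [Ux _] := Hx 0%N I.
    have /nbhs_ballP[r /= r0 rU] : nbhs x U by exact: open_nbhs_nbhs.
    have [k kr] : exists k, k.+1%:R^-1 <= r.
      exists (Num.truncn r^-1); rewrite -[leRHS]invrK lef_pV2 ?posrE ?invr_gt0 //.
      exact/ltW/truncnS_gt.
    have [_] := Hx k I; apply => -[y Uy /interior_subset yx]; apply: Uy; apply: rU.
    by apply: ball_sym; exact: le_ball yx.
by exists (F n), U; split.
Qed.

(** A countable union of open sets is open, but only a finite union of the closed sets
can be used from inside: continuity from above lets a finite one suffice. *)
Lemma sandwiched_sigma_algebra : sigma_algebra setT sandwiched.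
Proof.
split.
- by move=> e e0; exists set0, set0; rewrite setD0 measure0 lte_fin; split=> //; exact: closed0.
- move=> B HB e e0; have [F [U [cF oU FB BU FUe]]] := HB e e0.
  exists (~` U), (~` F); split.
  + exact: open_closedC.
  + exact: closed_openC.
  + by rewrite setTD; exact: subsetC.
  + by rewrite setTD; exact: subsetC.
  + by rewrite setDE setCK setIC -setDE.
- move=> B HB e e0; have e2 : 0 < e / 2 by rewrite divr_gt0.
  have eps n : 0 < e / 2 / (2 ^ n.+1)%:R by rewrite divr_gt0 // ltr0n expn_gt0.
  have FU n : exists FU : set X * set X, [/\ closed FU.1, open FU.2, FU.1 `<=` B n,
      B n `<=` FU.2 & (mu (FU.2 `\` FU.1) < (e / 2 / (2 ^ n.+1)%:R)%:E)%E].
    by have [F [U H]] := HB n _ (eps n); exists (F, U).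
  have [FUn HFU] := choice FU; pose F n := (FUn n).1; pose U n := (FUn n).2.
  have cF n : closed (F n) by have [] := HFU n.
  have oU n : open (U n) by have [] := HFU n.
  have mF n : measurable (F n : set (borelRd R d)) by exact: closed_borel.
  have mU n : measurable (U n : set (borelRd R d)) by exact: open_borel.
  pose UU := \bigcup_n U n.
  have oUU : open UU by apply: bigcup_open => n _.
  pose D N := UU `\` \bigcup_(n < N) F n.
  have cFN N : closed (\bigcup_(n < N) F n).
    by apply: closed_bigcup => // n _; exact: cF.
  have [N HN] : exists N, (mu (D N) < e%:E)%E.
    apply: eventually_small.
    - by move=> N; apply: measurableD; [exact: open_borel|exact: closed_borel].
    - move=> m n mn; apply/subsetPset => x [Ux nFx]; split=> // -[k /= km Fk].
      by apply: nFx; exists k => //=; exact: leq_trans km mn.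
    - apply: (@le_lt_trans _ _ (e / 2)%:E); last by rewrite lte_fin ltr_pdivrMr // ltr_pMr // ltr1n.
      have sub : \bigcap_N D N `<=` \bigcup_n (U n `\` F n).
        move=> x Hx; have [[n _ Un] _] := Hx 0%N I; exists n => //; split=> // Fn.
        by have [_] := Hx n.+1 I; apply; exists n => //=.
      have mUF n : measurable (U n `\` F n : set (borelRd R d)) by exact: measurableD.
      apply: (@le_trans _ _ (\sum_(0 <= n <oo) mu (U n `\` F n))%E).
        apply: measure_sigma_subadditive => //.
        apply: bigcapT_measurable => n; apply: measurableD; [exact: open_borel|exact: closed_borel].
      apply: (@le_trans _ _ (\sum_(0 <= n <oo) (e / 2 / (2 ^ n.+1)%:R)%:E)%E).
        apply: lee_nneseries => [n *|n *]; first exact: measure_ge0.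
        by have [_ _ _ _ /ltW] := HFU n.
      exact: epsilon_trick0 (ltW e2).
  exists (\bigcup_(n < N) F n), UU; split=> //.
  + by move=> x [n _ Fn]; exists n => //; have [_ _ FB _ _] := HFU n; exact: FB.
  + by move=> x [n _ Bn]; exists n => //; have [_ _ _ BU _] := HFU n; exact: BU.
Qed.

Lemma borel_sandwiched (B : set (borelRd R d)) : measurable B -> sandwiched B.
Proof. by apply: smallest_sub; [exact: sandwiched_sigma_algebra|exact: open_sandwiched]. Qed.

Lemma compact_support_radon (K : set X) : compact K -> mu (~` K) = 0%E -> is_radon mu.
Proof.
move=> cK muK; have clK : closed K by exact: compact_closed.
split=> [C cC|B mB].
  by apply: mu_lty; apply: closed_borel; exact: compact_closed.
apply/eqP; rewrite eq_le; apply/andP; split; last first.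
  apply: ge_ereal_sup => _ [C [cC CB] <-]; apply: le_measure; rewrite ?inE //.
  by apply: closed_borel; exact: compact_closed.
apply/lee_addgt0Pr => e e0; have [F [U [cF oU FB BU FUe]]] := borel_sandwiched mB e0.
have mF := closed_borel cF; have mK := closed_borel clK.
have mFK : measurable (F `&` K : set (borelRd R d)) by exact: measurableI.
apply: (@le_trans _ _ (mu (F `&` K) + e%:E)%E); last first.
  rewrite leeD2r //; apply: ereal_sup_ubound; exists (F `&` K) => //.
  split; last by move=> x [/FB].
  by rewrite setIC; apply: (subclosed_compact (closedI clK cF) cK) => x [].
have sub : B `<=` (F `&` K) `|` ((U `\` F) `|` ~` K).
  move=> x Bx; have [Kx|Kx] := pselect (K x); last by right; right.
  have [Fx|Fx] := pselect (F x); first by left.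
  by right; left; split=> //; exact: BU.
have mUF : measurable (U `\` F : set (borelRd R d)) by apply: measurableD => //; exact: open_borel.
have mCK : measurable (~` K : set (borelRd R d)) by exact: measurableC.
apply: (@le_trans _ _ (mu ((F `&` K) `|` ((U `\` F) `|` ~` K)))).
  by apply: le_measure; rewrite ?inE //; apply: measurableU => //; exact: measurableU.
have mrest := measurableU _ _ mUF mCK.
apply: (@le_trans _ _ (mu (F `&` K) + mu ((U `\` F) `|` ~` K))%E).
  exact: (@measureU2 _ _ _ mu).
rewrite leeD2l //; apply: (@le_trans _ _ (mu (U `\` F) + mu (~` K))%E).
  exact: (@measureU2 _ _ _ mu).
by rewrite muK adde0 ltW.
Qed.

End Regularity.

(** * Moment functionals and the main result *)

(** Haviland's theorem on a compact set. The measure is the image of Lebesgue measure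
on the root slot under the limit map. *)
Lemma haviland_compact (R : realType) (d : nat) (K : set 'rV[R]_d)
    (L : {scalar (polyring R d)}) : compact K ->
  (forall h : polyring R d, (forall x, K x -> 0 < peval h x) -> 0 <= L h) ->
  moment_functional K L.
Proof.
move=> cK Lpos.
have Lpos0 (h : polyring R d) : (forall x, K x -> 0 <= peval h x) -> 0 <= L h.
  move=> h0; have L1 : 0 <= L 1.
    by apply: Lpos => x _; rewrite -(scale1r 1) pevalC.
  apply/ler_addgt0Pr => e e0; have c0 : 0 < L 1 + 1 by rewrite ltr_wpDl.
  have : 0 <= L (h + (e / (L 1 + 1))%:A).
    by apply: Lpos => x Kx; rewrite pevalD pevalC ltr_wpDl ?h0 // divr_gt0.
  rewrite linearD linearZ /= => /le_trans; apply; rewrite lerD2l.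
  by rewrite mulrAC ler_pdivrMr // ler_wpM2l ?ltW // ltrDl.
have Kbd (p : polyring R d) : bounded_on K (peval p).
  by have [] := peval_bounded_oscillation cK p.
have [Lam [LamP LamE]] := positive_extension Kbd Lpos0.
pose nu := slot_measure K Lam; pose T := limit_point K Lam.
have mT : measurable_fun [set: measurableTypeR R] (T : measurableTypeR R -> borelRd R d).
  exact: measurable_limit_point.
have [mu muE] : exists mu : {measure set (borelRd R d) -> \bar R},
    mu = pushforward nu (T : measurableTypeR R -> borelRd R d) :> (set (borelRd R d) -> \bar R).
  by exists (measure_function_pushforward__canonical__measure_function_Measure nu mT).
have mu_fin : (mu setT < +oo)%E.
  by rewrite muE /pushforward preimage_setT; exact: slot_measure_fin.
have muK : mu (~` K) = 0%E.
  rewrite muE /pushforward /nu /slot_measure /= /mrestr.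
  rewrite (_ : _ `&` _ = set0) ?measure0 //.
  by apply/seteqP; split=> // t [/= nK st]; apply: nK; exact: limit_point_in.
have mp (p : polyring R d) : measurable_fun [set: borelRd R d]
    (fun x : borelRd R d => (peval p x)%:E).
  by apply/measurable_EFinP; exact: measurable_peval.
have ip (p : polyring R d) :
    nu.-integrable [set: measurableTypeR R] (EFin \o (fun t => peval p (T t))).
  exact: integrable_peval_limit.
exists mu; split=> [||p|p].
- exact: compact_support_radon muK.
- exact: muK.
- rewrite muE; have := integrable_pushforward mT (mu := nu) (D := setT) (mp p).
  by rewrite preimage_setT => /(_ (ip p) measurableT).
- rewrite muE; have := integral_pushforward mT (mu := nu) (D := setT) (mp p).
  rewrite preimage_setT => /(_ (ip p) measurableT) ->.
  rewrite -LamE -(limit_integral LamP cK p) /Rintegral fineK //.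
  exact: integrable_fin_num (ip p).
Qed.

Theorem theorem12p51 (R : realType) (d r : nat) (r_gt0 : (0 < r)%N)
    (f : 'I_r -> polyring R d) (cK : compact (semialg f)) :
  exists s : nat, (0 < s)%N /\ exists p : 'I_s -> polyring R d,
    [/\ archimedean (semiring_gen (fp_gens f p)),
        (forall h : polyring R d,
           (forall x : 'rV[R]_d, semialg f x -> 0 < peval h x) ->
           fp_sum f p h) &
        (forall L : {scalar (polyring R d)},
           (forall (e : 'I_r -> bool) (n : 'I_r -> nat) (k : 'I_s -> nat),
              0 <= L (fp_term f p 1 e n k)) ->
           moment_functional (semialg f) L)].
Proof.
have [s [s_gt0 [p bd]]] := exists_archimedean_squares cK.
have pos h hpos : fp_sum f p h :=
  semiring_gen_fp_sum (bounded_positivstellensatz bd (h := h) hpos).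
exists s; split=> //; exists p; split=> // [a|L Lpos].
  have [l [Sl _]] := bd a.
  exact: (bounded_weaken (semiring_gen_semiring (fp_gens f p)) Sl).
apply: haviland_compact => // h /pos[N [alpha [e [n [k [alpha0 ->]]]]]].
rewrite linear_sum; apply: sumr_ge0 => t _.
have := Lpos (e t) (n t) (k t); rewrite /fp_term scale1r linearZ /=.
exact: mulr_ge0.
Qed.
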